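(* Let $\mathfrak{g}$ be a notion of guarding, either atom guarding or loose guarding, let $\sigma$ be a relational vocabulary and let $n,k$ be positive integers. For any $\mathfrak{g}$-guarded sentence $\varphi$ in $n$ variables of guarded-quantifier rank at most $k$, the following are equivalent: (1) $\varphi$ is preserved under homomorphisms between finite $\sigma$-structures; (2) $\varphi$ is logically equivalent over finite $\sigma$-structures to an existential positive $\mathfrak{g}$-guarded sentence in $n$ variables of guarded-quantifier rank at most $k$.
   Context: A relational vocabulary has no function or constant symbols; equality is allowed. Guarded formulas are built from atomic formulas by Boolean connectives and guarded quantification: if $\phi(\bar x,\bar y)$ is guarded so are $\exists\bar x.\,(G(\bar x,\bar y)\wedge\phi)$ and $\forall\bar x.\,(G(\bar x,\bar y)\to\phi)$ for a guard $G$. Atom guarding: $G$ is an atomic formula containing all variables of $\bar x,\bar y$. Loose guarding: $G$ is a conjunction of atomic formulas such that every pair of variables, one from $\bar x$ and the other from $\bar x,\bar y$, occurs together in some conjunct. ''In $n$ variables'' means using at most $n$ distinct variables; guarded-quantifier rank is the maximum nesting depth of guarded quantifiers. Existential positive guarded sentences use only $\vee,\wedge$ and guarded existential quantification. *)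

(* Defs.v *)
From mathcomp Require Import all_boot.

Set Implicit Arguments.
Unset Strict Implicit.
Unset Printing Implicit Defensive.

Record vocabulary : Type := Vocabulary {
  symbol : Type;
  arity : symbol -> nat
}.

(* The carrier may be empty. *)
Record fin_structure (sg : vocabulary) : Type := FinStructure {
  carrier :> finType;
  interp : forall r : symbol sg, pred ((arity r).-tuple carrier)
}.

Definition is_hom (sg : vocabulary) (A B : fin_structure sg) (h : A -> B) : Prop :=
  forall (r : symbol sg) (t : (arity r).-tuple A),
    interp t -> interp (map_tuple h t).

Inductive atom (sg : vocabulary) : Type :=
| Rel (r : symbol sg) of (arity r).-tuple nat
| Eq of nat & nat.
Arguments Eq {sg}.

(* [FEx xs G f] is "exists xs, (G /\ f)" and [FAll xs G f] is
   "forall xs, (G -> f)", where the guard G is the conjunction of a list of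
   atoms.  FTrue and FFalse are the empty conjunction and disjunction. *)
Inductive formula (sg : vocabulary) : Type :=
| FTrue
| FFalse
| FAtom of atom sg
| FNot of formula sg
| FAnd of formula sg & formula sg
| FOr of formula sg & formula sg
| FEx of seq nat & seq (atom sg) & formula sg
| FAll of seq nat & seq (atom sg) & formula sg.
Arguments FTrue {sg}.
Arguments FFalse {sg}.

Definition atom_vars (sg : vocabulary) (a : atom sg) : seq nat :=
  match a with
  | Rel _ vs => vs
  | Eq x y => [:: x; y]
  end.

Definition conj_vars (sg : vocabulary) (G : seq (atom sg)) : seq nat :=
  flatten [seq atom_vars a | a <- G].

Fixpoint free_vars (sg : vocabulary) (f : formula sg) : seq nat :=
  match f with
  | FTrue | FFalse => [::]
  | FAtom a => atom_vars a
  | FNot f1 => free_vars f1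
  | FAnd f1 f2 | FOr f1 f2 => free_vars f1 ++ free_vars f2
  | FEx xs G f1 | FAll xs G f1 =>
      [seq y <- conj_vars G ++ free_vars f1 | y \notin xs]
  end.

Fixpoint all_vars (sg : vocabulary) (f : formula sg) : seq nat :=
  match f with
  | FTrue | FFalse => [::]
  | FAtom a => atom_vars a
  | FNot f1 => all_vars f1
  | FAnd f1 f2 | FOr f1 f2 => all_vars f1 ++ all_vars f2
  | FEx xs G f1 | FAll xs G f1 => xs ++ conj_vars G ++ all_vars f1
  end.

Definition num_vars (sg : vocabulary) (f : formula sg) : nat :=
  size (undup (all_vars f)).

Fixpoint guarded_rank (sg : vocabulary) (f : formula sg) : nat :=
  match f with
  | FTrue | FFalse | FAtom _ => 0
  | FNot f1 => guarded_rank f1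
  | FAnd f1 f2 | FOr f1 f2 => maxn (guarded_rank f1) (guarded_rank f2)
  | FEx _ _ f1 | FAll _ _ f1 => (guarded_rank f1).+1
  end.

Inductive guarding : Type := AtomGuarding | LooseGuarding.

(* [is_guard g xs G zs]: G guards the quantification of xs in front of a
   formula with free variables zs.  The tuple ys of remaining variables consists
   of those variables of G and zs that are not in xs. *)
Definition is_guard (g : guarding) (sg : vocabulary)
    (xs : seq nat) (G : seq (atom sg)) (zs : seq nat) : bool :=
  match g with
  | AtomGuarding =>
      if G is [:: a] then all (mem (atom_vars a)) (xs ++ zs) else false
  | LooseGuarding =>
      all (fun x =>
        all (fun z =>
          has (fun a => (x \in atom_vars a) && (z \in atom_vars a)) G)
          (xs ++ conj_vars G ++ zs)) xs
  end.

Fixpoint guarded (g : guarding) (sg : vocabulary) (f : formula sg) : bool :=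
  match f with
  | FTrue | FFalse | FAtom _ => true
  | FNot f1 => guarded g f1
  | FAnd f1 f2 | FOr f1 f2 => guarded g f1 && guarded g f2
  | FEx xs G f1 | FAll xs G f1 => is_guard g xs G (free_vars f1) && guarded g f1
  end.

Fixpoint existential_positive (sg : vocabulary) (f : formula sg) : bool :=
  match f with
  | FTrue | FFalse | FAtom _ => true
  | FAnd f1 f2 | FOr f1 f2 => existential_positive f1 && existential_positive f2
  | FEx _ _ f1 => existential_positive f1
  | FNot _ | FAll _ _ _ => false
  end.

Definition is_sentence (sg : vocabulary) (f : formula sg) : bool :=
  nilp (free_vars f).

Definition guarded_sentence (g : guarding) (n k : nat) (sg : vocabulary)
    (f : formula sg) : Prop :=
  [/\ guarded g f, is_sentence f, num_vars f <= n & guarded_rank f <= k].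

(* Assignments are partial so that sentences make sense in the empty structure,
   over which there is no total assignment. *)
Definition assignment (sg : vocabulary) (A : fin_structure sg) : Type :=
  nat -> option A.

Definition atom_holds (sg : vocabulary) (A : fin_structure sg)
    (e : assignment A) (a : atom sg) : Prop :=
  match a with
  | Rel r vs => exists t : (arity r).-tuple A,
      map e vs = map Some t /\ interp t
  | Eq x y => exists c : A, e x = Some c /\ e y = Some c
  end.

Fixpoint conj_holds (sg : vocabulary) (A : fin_structure sg)
    (e : assignment A) (G : seq (atom sg)) : Prop :=
  if G is a :: G' then atom_holds e a /\ conj_holds e G' else True.

Definition reassigns (sg : vocabulary) (A : fin_structure sg) (xs : seq nat)
    (e e' : assignment A) : Prop :=
  (forall x, x \notin xs -> e' x = e x) /\
  (forall x, x \in xs -> exists c : A, e' x = Some c).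

Fixpoint holds (sg : vocabulary) (A : fin_structure sg) (e : assignment A)
    (f : formula sg) : Prop :=
  match f with
  | FTrue => True
  | FFalse => False
  | FAtom a => atom_holds e a
  | FNot f1 => ~ holds e f1
  | FAnd f1 f2 => holds e f1 /\ holds e f2
  | FOr f1 f2 => holds e f1 \/ holds e f2
  | FEx xs G f1 => exists e' : assignment A,
      reassigns xs e e' /\ (conj_holds e' G /\ holds e' f1)
  | FAll xs G f1 => forall e' : assignment A,
      reassigns xs e e' -> (conj_holds e' G -> holds e' f1)
  end.

Definition models (sg : vocabulary) (A : fin_structure sg) (f : formula sg) : Prop :=
  holds (fun=> None : option A) f.

Definition preserved_under_fin_homs (sg : vocabulary) (f : formula sg) : Prop :=
  forall (A B : fin_structure sg) (h : A -> B),
    is_hom h -> models A f -> models B f.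

Definition fin_equivalent (sg : vocabulary) (f1 f2 : formula sg) : Prop :=
  forall A : fin_structure sg, models A f1 <-> models A f2.

(* Main.v *)
(** The simulations considered play k rounds along the guarded quantifiers of phi and
    preserve its atoms.  A simulation from A to B starting at the empty position
    exists as soon as B satisfies every sentence that A satisfies in a certain finite
    list of existential positive guarded sentences of rank at most k over the
    variables of phi.  Hence psi can be the disjunction of the theories, within this
    list, of the models of phi, provided that preservation under homomorphisms implies
    preservation under these one-way simulations.

    Let A simulate into B.  Both A and B have a finite cover, with maps A -> cover(A)
    (homomorphic on the tuples matching an atom of phi) and cover(B) -> B, such that
    the two covers satisfy the same guarded formulas of rank at most k built from the
    atoms and quantifiers of phi; so A |= phi gives cover(A) |= phi, then
    cover(B) |= phi, then B |= phi.
    The vertices of the cover of B lie over elements of B and carry hash values which,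
    summed over a set of vertices, encode the theory of that set in some structure N
    mapping to B and equivalent to A from the empty position.  Any local configuration
    in such an N extending a given one can be found in the cover, because one new hash
    value always makes the sum correct; the N needed to answer a move is a finite tree
    unravelling of the structure of one cover glued to that of the other.  As in
    Hodkinson and Otto's construction of clique-faithful covers, additional colours
    make every set whose pairs lie in hyperedges a hyperedge, as loose guards require. *)
Require Import Defs.
From mathcomp Require Import all_boot ssralg zmodp.
From mathcomp Require Import boolp.
From Stdlib Require List.

Set Implicit Arguments.
Unset Strict Implicit.
Unset Printing Implicit Defensive.

(** * Partial assignments, finite conjunctions and disjunctions, renaming of atoms *)

Definition pcomp (N N' : Type) (p : N -> option N') (e : nat -> option N) x :=
  obind p (e x).

Section Basics.
Variable sg : vocabulary.
Implicit Types (a : atom sg) (G : seq (atom sg)) (f : formula sg).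
Implicit Types A B N : fin_structure sg.

Lemma atom_holds_def A (e : assignment A) a x :
  atom_holds e a -> x \in atom_vars a -> exists c, e x = Some c.
Proof.
case: a => [r vs|y z] /=.
  case=> t [E _] xv; have : e x \in map e vs by apply: map_f.
  by rewrite E => /mapP[c _ ->]; exists c.
by case=> c [E1 E2]; rewrite !inE => /orP[]/eqP->; exists c.
Qed.

Lemma atom_holds_ext A (e e' : assignment A) a :
  {in atom_vars a, e =1 e'} -> atom_holds e a -> atom_holds e' a.
Proof.
case: a => [r vs|y z] /= E.
  case=> t [Et It]; exists t; split=> //; rewrite -Et.
  by apply/eq_in_map => x xv; rewrite E.
by case=> c; rewrite !E ?inE ?eqxx ?orbT //; exists c.
Qed.

Lemma atom_holds_hom A B (h : A -> B) (e : assignment A) a : is_hom h ->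
  atom_holds e a -> atom_holds (pcomp (fun x => Some (h x)) e) a.
Proof.
move=> hh; case: a => [r vs|y z] /=.
  case=> t [Et It]; exists (map_tuple h t); split; last exact: hh.
  rewrite (map_comp (obind (fun x => Some (h x))) e) Et /= -!map_comp.
  exact: eq_map.
by case=> c [E1 E2]; exists (h c); rewrite /pcomp E1 E2.
Qed.

Lemma map_Some_in (T : eqType) (d : nat -> option T) vs (t : seq T) x w :
  map d vs = map Some t -> x \in vs -> d x = Some w -> w \in t.
Proof.
move=> E xv Ex; have : d x \in map Some t by rewrite -E map_f.
by rewrite Ex => /mapP[w' h [->]].
Qed.

Lemma Eq_vals A (d : assignment A) y y' x x' w w' :
  atom_holds d (Eq y y' : atom sg) -> x \in [:: y; y'] -> x' \in [:: y; y'] ->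
  d x = Some w -> d x' = Some w' -> w = w'.
Proof.
by case=> c [E1 E2]; rewrite !inE => /orP[]/eqP-> /orP[]/eqP->; rewrite ?E1 ?E2 => -[<-] [<-].
Qed.

Lemma conj_holdsP A (e : assignment A) G :
  conj_holds e G <-> forall a, List.In a G -> atom_holds e a.
Proof.
elim: G => [|a G IH] //=; split.
  by case=> h1 /IH h2 b [<-|/h2].
by move=> h; split; [apply: h; left|apply/IH => b bG; apply: h; right].
Qed.

Lemma mem_conj_vars G x :
  x \in conj_vars G <-> exists2 a, List.In a G & x \in atom_vars a.
Proof.
rewrite /conj_vars; elim: G => [|a G IH] /=; first by split=> // -[].
rewrite mem_cat; split.
  by case/orP=> [xa|/IH[b bG xb]]; [exists a; [left|]|exists b; [right|]].
case=> b [<-|bG] xb; first by rewrite xb.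
by apply/orP; right; apply/IH; exists b.
Qed.

Lemma conj_holds_def A (e : assignment A) G x :
  conj_holds e G -> x \in conj_vars G -> exists c, e x = Some c.
Proof.
by move=> /conj_holdsP eG /mem_conj_vars[a aG xa]; apply: atom_holds_def xa; apply: eG.
Qed.

Lemma ep_hom A B (h : A -> B) f : is_hom h -> existential_positive f ->
  forall e : assignment A,
  holds e f -> holds (pcomp (fun x => Some (h x)) e) f.
Proof.
move=> hh; elim: f => //=.
- by move=> a _ e; apply: atom_holds_hom.
- by move=> f1 IH1 f2 IH2 /andP[/IH1{}IH1 /IH2{}IH2] e [/IH1 ? /IH2 ?].
- by move=> f1 IH1 f2 IH2 /andP[/IH1{}IH1 /IH2{}IH2] e [/IH1|/IH2]; [left|right].
move=> xs G f IH /IH{}IH e [e' [[eo ei] [eG ef]]].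
exists (pcomp (fun x => Some (h x)) e'); split.
  split=> x xx; first by rewrite /pcomp eo.
  by have [c E] := ei x xx; exists (h c); rewrite /pcomp E.
split; last exact: IH.
by apply/conj_holdsP => a aG; apply: atom_holds_hom => //; move/conj_holdsP: eG; apply.
Qed.

Definition bigand (s : seq (formula sg)) := foldr (@FAnd sg) FTrue s.
Definition bigor (s : seq (formula sg)) := foldr (@FOr sg) FFalse s.

Lemma holds_bigand A (e : assignment A) s :
  holds e (bigand s) <-> forall f, List.In f s -> holds e f.
Proof.
elim: s => [|f s IH] //=; split.
  by case=> h1 /IH h2 b [<-|/h2].
by move=> h; split; [apply: h; left|apply/IH => b bG; apply: h; right].
Qed.

Lemma holds_bigor A (e : assignment A) s :
  holds e (bigor s) <-> exists2 f, List.In f s & holds e f.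
Proof.
elim: s => [|f s IH] /=; first by split=> // -[].
split.
  by case=> [h1|/IH[b bG xb]]; [exists f; [left|]|exists b; [right|]].
case=> b [<-|bG] xb; first by left.
by right; apply/IH; exists b.
Qed.

(** Everything asked of the final formula except being closed. The bound on the number of variables
    becomes membership in a fixed list, a condition stable under conjunction and disjunction. *)
Definition good (g : guarding) (V : seq nat) j (f : formula sg) :=
  [&& guarded g f, existential_positive f, all (mem V) (all_vars f)
    & guarded_rank f <= j].

Lemma good_bigand g V j s : (forall f, List.In f s -> good g V j f) ->
  good g V j (bigand s).
Proof.
elim: s => [|f s IH] //= h.
have /and4P[a b c d] := h f (or_introl erefl).
have /and4P[a' b' c' d'] := IH (fun f' hf' => h f' (or_intror hf')).
by rewrite /good /= a b a' b' all_cat c c' geq_max d d'.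
Qed.

Lemma good_bigor g V j s : (forall f, List.In f s -> good g V j f) ->
  good g V j (bigor s).
Proof.
elim: s => [|f s IH] //= h.
have /and4P[a b c d] := h f (or_introl erefl).
have /and4P[a' b' c' d'] := IH (fun f' hf' => h f' (or_intror hf')).
by rewrite /good /= a b a' b' all_cat c c' geq_max d d'.
Qed.

Lemma free_bigand s x : x \in free_vars (bigand s) <->
  exists2 f, List.In f s & x \in free_vars f.
Proof.
elim: s => [|f s IH] /=; first by split=> // -[].
rewrite mem_cat; split.
  by case/orP=> [h1|/IH[b bG xb]]; [exists f; [left|]|exists b; [right|]].
case=> b [<-|bG] xb; first by rewrite xb.
by apply/orP; right; apply/IH; exists b.
Qed.

Lemma free_bigor s x : x \in free_vars (bigor s) <->
  exists2 f, List.In f s & x \in free_vars f.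
Proof.
elim: s => [|f s IH] /=; first by split=> // -[].
rewrite mem_cat; split.
  by case/orP=> [h1|/IH[b bG xb]]; [exists f; [left|]|exists b; [right|]].
case=> b [<-|bG] xb; first by rewrite xb.
by apply/orP; right; apply/IH; exists b.
Qed.

Definition ren_atom (w : nat -> nat) a : atom sg :=
  match a with
  | Rel r vs => Rel (map_tuple w vs)
  | Eq x y => Eq (w x) (w y)
  end.

Lemma atom_vars_ren w a : atom_vars (ren_atom w a) = map w (atom_vars a).
Proof. by case: a. Qed.

Lemma atom_holds_ren A (e : assignment A) w a :
  atom_holds e (ren_atom w a) <-> atom_holds (e \o w) a.
Proof.
case: a => [r vs|x y] //=.
by split=> -[t [E I]]; exists t; split=> //; rewrite -E -map_comp.
Qed.

Lemma eq_ren_atom w w' a : {in atom_vars a, w =1 w'} ->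
  ren_atom w a = ren_atom w' a.
Proof.
case: a => [r vs|x y] /= E; last by rewrite !E ?inE ?eqxx ?orbT.
by congr (Rel _); apply/val_inj/eq_in_map.
Qed.

Lemma conj_vars_ren w G : conj_vars (map (ren_atom w) G) = map w (conj_vars G).
Proof.
rewrite /conj_vars map_flatten -!map_comp; congr flatten.
by apply: eq_map => a /=; rewrite atom_vars_ren.
Qed.

End Basics.

(** * Finite enumerations of sublists and words, and injective choice *)

Section Lists.

Fixpoint subs (T : Type) (s : seq T) : seq (seq T) :=
  if s is x :: s' then subs s' ++ map (cons x) (subs s') else [:: [::]].

Lemma In_subs (T : Type) (P : pred T) (s : seq T) : List.In (filter P s) (subs s).
Proof.
elim: s => [|x s IH] /=; first by left.
apply: List.in_or_app; case: (P x); last by left.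
by right; apply: (List.in_map (cons x)).
Qed.

Lemma In_filter (T : Type) (P : pred T) (s : seq T) x :
  List.In x (filter P s) <-> List.In x s /\ P x.
Proof.
elim: s => [|y s IH] /=; first by split=> // -[].
case E: (P y) => /=; split.
- by case=> [<-|/IH[]]; [split=> //; left|split=> //; right].
- by case=> -[<-|h1] h2; [left|right; apply/IH].
- by case/IH=> *; split=> //; right.
- by case=> -[<-|h1] h2; [rewrite E in h2|apply/IH].
Qed.

Fixpoint words (s : seq nat) n : seq (seq nat) :=
  if n is n'.+1 then flatten [seq map (cons x) (words s n') | x <- s] else [:: [::]].

Lemma mem_words s w : all (mem s) w -> w \in words s (size w).
Proof.
elim: w => [|x w IH] //= /andP[xs /IH{}IH].
apply/flattenP; exists (map (cons x) (words s (size w))); last exact: map_f.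
exact: (map_f (fun x => map _ _)).
Qed.

Lemma InP (T : eqType) (x : T) (s : seq T) : reflect (List.In x s) (x \in s).
Proof.
elim: s => [|y s IH] /=; first by right.
rewrite inE; case: eqVneq => [->|ne] /=; first by left; left.
by apply: (iffP IH) => [|[/esym/eqP|//]]; [right|rewrite (negPf ne)].
Qed.

(** The i-th element of [X] receives the i-th entry of [C]. Names of variables, colours of vertices
    and indices of keys are all chosen in this way. *)
Lemma fresh (A : finType) (B : eqType) (b0 : B) (X : {set A}) (C : seq B) :
  uniq C -> #|X| <= size C ->
  exists nu : A -> B, (forall a, a \in X -> nu a \in C) /\ {in X &, injective nu}.
Proof.
move=> uC le; exists (fun a => nth b0 C (index a (enum X))).
have lt a : a \in X -> index a (enum X) < size C.
  by move=> aX; apply: leq_trans le; rewrite cardE index_mem mem_enum.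
split=> [a aX|a b aX bX]; first by rewrite mem_nth // lt.
move/eqP; rewrite nth_uniq ?lt // => /eqP.
by move/(congr1 (nth a (enum X))); rewrite !nth_index ?mem_enum.
Qed.

End Lists.

(** * Simulations along the guarded quantifiers of a formula *)

Section Simulation.
Variables (sg : vocabulary) (g : guarding) (V : seq nat).
(* [V], [AA] and [MM] stand for the variables, the atoms (those in guards included)
   and the guarded quantifiers of the formula under consideration. *)
Variables (AA : seq (atom sg)) (MM : seq (seq nat * seq (atom sg))).
Hypothesis AA_V : forall a, List.In a AA -> {subset atom_vars a <= V}.
Hypothesis MM_AA : forall xs G a, List.In (xs, G) MM -> List.In a G -> List.In a AA.
Implicit Types N : fin_structure sg.

(** The variables that may occur free under the quantifier, tested one at a time. A loose guard with
    [xs] empty makes every variable live. *)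
Definition live xs (G : seq (atom sg)) z := is_guard g xs G [:: z].

(** Once [xs] and the guard itself pass the test, which is the hypothesis, both kinds of guarding
    constrain each further free variable separately. *)
Lemma is_guard_live xs (G : seq (atom sg)) zs : is_guard g xs G [::] ->
  is_guard g xs G zs = all (live xs G) zs.
Proof.
rewrite /live; case: g => /=.
  case: G => [|a []] // h; rewrite cats0 in h.
  by rewrite all_cat h /=; apply: eq_all => z; rewrite all_cat h /= andbT.
move=> h.
pose cov x z := has (fun a => (x \in atom_vars a) && (z \in atom_vars a)) G.
have E z : all (fun x => all (cov x) (xs ++ conj_vars G ++ [:: z])) xs =
    all (cov^~ z) xs.
  apply/idP/idP => /allP H; apply/allP => x xx.
    by move/allP: (H x xx); apply; rewrite !mem_cat !inE eqxx !orbT.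
  move/allP: h => /(_ x xx); rewrite cats0 !all_cat => /andP[-> ->] /=.
  by rewrite andbT; apply: H.
rewrite (eq_all E) {E}.
apply/idP/idP => /allP H; apply/allP => z zz.
  apply/allP => x xx; move/allP: (H x xx); apply.
  by rewrite !mem_cat zz !orbT.
move/allP: h => /(_ z zz); rewrite cats0 !all_cat => /andP[-> ->] /=.
by apply/allP => y yy; move/allP: (H y yy); apply.
Qed.

(* Both kinds of guards are used only through this pairwise covering property. *)
Lemma live_pair xs (G : seq (atom sg)) x z : is_guard g xs G [::] ->
  x \in xs -> live xs G z ->
  exists a, [/\ List.In a G, x \in atom_vars a & z \in atom_vars a].
Proof.
rewrite /live; case: g => /=.
  case: G => [|a []] // _ xx; rewrite all_cat /= andbT => /andP[/allP h hz].
  by exists a; split=> //; [left|apply: h].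
move=> _ xx /allP/(_ x xx)/allP/(_ z).
rewrite !mem_cat inE eqxx !orbT => /(_ isT).
elim: G => [|a G IH] //= /orP[/andP[h1 h2]|/IH[b [h1 h2 h3]]].
  by exists a; split=> //; left.
by exists b; split=> //; right.
Qed.

Lemma live_conj xs (G : seq (atom sg)) x : is_guard g xs G [::] ->
  xs != [::] -> x \in conj_vars G -> live xs G x.
Proof.
rewrite /live; case: g => /=.
  case: G => [|a []] // h _; rewrite /conj_vars /= cats0 => xa.
  by rewrite all_cat /= xa andbT; rewrite cats0 in h; rewrite h.
move=> /allP h _ xG; apply/allP => y yy.
move: (h y yy); rewrite cats0 !all_cat => /andP[-> H] /=; rewrite H /= andbT.
by move/allP: H; apply.
Qed.

Lemma live_conj_nil (G : seq (atom sg)) x : is_guard g [::] G [::] ->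
  x \in conj_vars G -> live [::] G x.
Proof.
rewrite /live; case: g => //=.
by case: G => [|a []] // _; rewrite /conj_vars /= cats0 => ->.
Qed.

Lemma live_guard xs (G : seq (atom sg)) x : is_guard g xs G [::] ->
  x \in conj_vars G -> live xs G x.
Proof.
case: xs => [|y ys]; first exact: live_conj_nil.
by move=> h; apply: live_conj.
Qed.

Lemma guard_xs xs (G : seq (atom sg)) x : is_guard g xs G [::] ->
  x \in xs -> x \in conj_vars G.
Proof.
case: g => /=.
  by case: G => [|a []] // + xx; rewrite cats0 /conj_vars /= cats0 => /allP; apply.
move=> /allP/(_ x) + xx => /(_ xx)/allP/(_ x); rewrite mem_cat xx => /(_ isT) H.
apply/mem_conj_vars; elim: G H => //= a G IH /orP[/andP[h _]|/IH[b h1 h2]].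
  by exists a => //; left.
by exists b => //; right.
Qed.

(** A move consists of the whole local assignment behind the quantifier, retained values
    included. *)
Definition move N xs G (d : assignment N) :=
  [/\ List.In (xs, G) MM, forall x c, d x = Some c -> x \in V /\ live xs G x
    & conj_holds d G].

Definition into N N' (p : N -> option N') (d : assignment N) (P : pred nat) :=
  forall x c, P x -> d x = Some c -> exists c', p c = Some c'.

Definition sim0 N N' (p : N -> option N') :=
  forall a, List.In a AA -> forall d : assignment N,
  into p d (mem (atom_vars a)) -> atom_holds d a -> atom_holds (pcomp p d) a.

(* A move may be made along any guarded quantifier of the formula, and the values of
   the variables it does not rebind must already lie in the domain of [p]. *)
Fixpoint sim j N N' (p : N -> option N') : Prop := sim0 p /\
  if j is j'.+1 then
    forall xs G (d : assignment N), move xs G d -> into p d (fun x => x \notin xs) ->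
    exists p2 : N -> option N', [/\ into p2 d predT,
      forall x c, x \notin xs -> d x = Some c -> p2 c = p c & sim j' p2]
  else True.

Lemma sim_sim0 j N N' (p : N -> option N') : sim j p -> sim0 p.
Proof. by case: j => [|j] []. Qed.

Lemma sim0_sub N N' (p p' : N -> option N') :
  (forall x y, p' x = Some y -> p x = Some y) -> sim0 p -> sim0 p'.
Proof.
move=> sub sp a aA d dp' da; apply: atom_holds_ext (sp a aA d _ da).
  move=> x xa /=; rewrite /pcomp.
  case E: (d x) => [c|] //=; have [c' Ec'] := dp' _ _ xa E.
  by rewrite Ec'; apply: sub.
by move=> x c xa E; have [c' Ec'] := dp' _ _ xa E; exists c'; apply: sub.
Qed.

(** A smaller domain leaves fewer moves to answer, and the answer found for [p] agrees with [p'] on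
    the retained values, where [p'] is defined. *)
Lemma sim_sub j N N' (p p' : N -> option N') :
  (forall x y, p' x = Some y -> p x = Some y) -> sim j p -> sim j p'.
Proof.
move=> sub; case: j => [|j] /= [s0 s]; split; try exact: sim0_sub s0; first by [].
move=> xs G d md dp'; have [|p2 [h1 h2 h3]] := s xs G d md.
  by move=> x c xx E; have [c' Ec'] := dp' x c xx E; exists c'; apply: sub.
exists p2; split=> // x c xx E.
by have [c' Ec'] := dp' x c xx E; rewrite Ec' (h2 x) //; apply: sub.
Qed.

Lemma sim_S j N N' (p : N -> option N') : sim j.+1 p -> sim j p.
Proof.
elim: j N N' p => [|j IH] N N' p [s0 s]; split=> // xs G d md dp.
by have [p2 [h1 h2 /IH h3]] := s xs G d md dp; exists p2.
Qed.

Lemma sim_leq i j N N' (p : N -> option N') : i <= j -> sim j p -> sim i p.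
Proof.
move=> /subnK <-; elim: (j - i) => [|n IH] //.
by rewrite addSn => /sim_S.
Qed.

Lemma move_atom N xs G (d : assignment N) a : move xs G d -> List.In a G ->
  List.In a AA /\ atom_holds d a.
Proof. by case=> h1 h2 /conj_holdsP h3 aG; split; [apply: MM_AA h1 aG|apply: h3]. Qed.

Lemma move_comp N N' xs G (d : assignment N) (p : N -> option N') :
  move xs G d -> into p d predT -> sim0 p -> move xs G (pcomp p d).
Proof.
move=> md dp sp; have [h1 h2 h3] := md; split=> //.
  move=> x c; rewrite /pcomp; case E: (d x) => [b|] //= _; exact: h2 E.
apply/conj_holdsP => a aG; have [aA da] := move_atom md aG.
by apply: sp => // x c _ E; apply: dp E.
Qed.

Lemma sim0_comp N1 N2 N3 (p : N1 -> option N2) (q : N2 -> option N3) :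
  sim0 p -> sim0 q -> sim0 (fun x => obind q (p x)).
Proof.
move=> sp0 sq0 a aA d dpq da.
have dp : into p d (mem (atom_vars a)).
  by move=> x c xa /(dpq _ _ xa) [c3]; case: (p c) => // c2 _; exists c2.
have := sq0 a aA _ _ (sp0 a aA d dp da); rewrite /pcomp => h.
apply: (atom_holds_ext (e := pcomp q (pcomp p d))).
  by move=> x _; rewrite /pcomp; case: (d x).
apply: h => x c2 xa; case E: (d x) => [c|] //= E2.
by have [c3] := dpq _ _ xa E; rewrite E2 /= => E3; exists c3.
Qed.

(** The answer of [p] turns a move in [N1] into a move in [N2] along the same quantifier, which [q]
    then answers. *)
Lemma sim_comp j N1 N2 N3 (p : N1 -> option N2) (q : N2 -> option N3) :
  sim j p -> sim j q -> sim j (fun x => obind q (p x)).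
Proof.
elim: j N1 N2 N3 p q => [|j IH] N1 N2 N3 p q sp sq;
  have s0 := sim0_comp (sim_sim0 sp) (sim_sim0 sq); split=> // xs G d md dpq.
have dp : into p d (fun x => x \notin xs).
  by move=> x c xa /(dpq _ _ xa) [c3]; case: (p c) => // c2 _; exists c2.
have [p2 [h1 h2 h3]] := sp.2 xs G d md dp.
have md' := move_comp md h1 (sim_sim0 h3).
have [|q2 [k1 k2 k3]] := sq.2 xs G _ md'.
  move=> x c2 xa; rewrite /pcomp; case E: (d x) => [c|] //=.
  rewrite (h2 _ _ xa E) => E2.
  by have [c3] := dpq _ _ xa E; rewrite E2 /= => E3; exists c3.
exists (fun x => obind q2 (p2 x)); split; last exact: IH.
  move=> x c _ E; have [c2 E2] := h1 x c isT E; rewrite E2 /=.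
  by apply: (k1 x) => //; rewrite /pcomp E.
move=> x c xa E; rewrite (h2 x) //; have [c2 E2] := dp _ _ xa E; rewrite E2 /=.
by apply: (k2 x) => //; rewrite /pcomp E /= (h2 x).
Qed.

(** A homomorphism answers every move by itself. *)
Lemma sim_hom j N N' (h : N -> N') : is_hom h -> sim j (fun x => Some (h x)).
Proof.
move=> hh; elim: j => [|j IH]; split=> //; try by move=> a _ d _; apply: atom_holds_hom.
by move=> xs G d _ _; exists (fun x => Some (h x)); split=> // x c _ _; exists (h c).
Qed.

Lemma sim_id j N : sim j (fun x : N => Some x).
Proof.
apply: (@sim_hom j N N id) => r t; congr (is_true (interp _)).
by apply: val_inj; rewrite /= map_id.
Qed.

(* A renaming of [V] is encoded by the word of its values, so that [cand] ranges over
   a finite list. *)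
Definition wren (w : seq nat) x := nth 0 w (index x V).

Lemma wren_map rho x : x \in V -> wren (map rho V) x = rho x.
Proof. by move=> xV; rewrite /wren (nth_map 0) ?index_mem // nth_index. Qed.

Definition wordsV := words V (size V).

Definition cand0 : seq (formula sg) := List.flat_map (fun a =>
  List.map (fun w => FAtom (ren_atom (wren w) a)) wordsV) AA.

Definition cand_step (C : seq (formula sg)) : seq (formula sg) :=
  List.flat_map (fun ys => List.flat_map (fun mv : seq nat * seq (atom sg) =>
    List.flat_map (fun w => List.map (fun S =>
      FEx ys (map (ren_atom (wren w)) mv.2) (bigand S)) (subs C))
    wordsV) MM) (subs V).

(** A finite list even over an infinite vocabulary: atoms and guards come from [AA] and [MM] up to
    renaming inside [V], and each level quantifies conjunctions of members of the previous one.
    Filtering by [good] discards the combinations that are not guarded. *)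
Fixpoint cand j : seq (formula sg) :=
  filter (good g V j) (cand0 ++ if j is j'.+1 then cand_step (cand j') else [::]).

Lemma cand_good j f : List.In f (cand j) -> good g V j f.
Proof. by case: j => [|j] /In_filter[]. Qed.

Lemma wordsV_map rho : {in V, forall x, rho x \in V} -> List.In (map rho V) wordsV.
Proof.
move=> h; apply/InP; rewrite /wordsV -(size_map rho); apply: mem_words.
by apply/allP => _ /mapP[x xV ->]; apply: h.
Qed.

Lemma cand_atom j a rho : {in V, forall x, rho x \in V} -> List.In a AA ->
  List.In (FAtom (ren_atom rho a)) (cand j).
Proof.
move=> h aA.
have E : ren_atom rho a = ren_atom (wren (map rho V)) a.
  by apply: eq_ren_atom => x xa; rewrite wren_map //; apply: AA_V xa.
have h1 : List.In (FAtom (ren_atom rho a)) cand0.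
  rewrite /cand0; apply/List.in_flat_map; exists a; split=> //.
  apply/List.in_map_iff; exists (map rho V); split; first by rewrite -E.
  exact: wordsV_map.
have h2 : good g V j (FAtom (ren_atom rho a)).
  rewrite /good /= andbT atom_vars_ren; apply/allP => _ /mapP[x xa ->].
  by apply: h; apply: AA_V xa.
by case: j h2 => [|j] h2; apply/In_filter; split=> //; apply: List.in_or_app; left.
Qed.

Lemma cand_ex j ys xs G rho S : List.In ys (subs V) -> List.In (xs, G) MM ->
  {in V, forall x, rho x \in V} -> List.In S (subs (cand j)) ->
  good g V j.+1 (FEx ys (map (ren_atom rho) G) (bigand S)) ->
  List.In (FEx ys (map (ren_atom rho) G) (bigand S)) (cand j.+1).
Proof.
move=> h1 h2 h3 h4 h5; apply/In_filter; split=> //; apply: List.in_or_app; right.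
apply/List.in_flat_map; exists ys; split=> //.
apply/List.in_flat_map; exists (xs, G); split=> //.
apply/List.in_flat_map; exists (map rho V); split; first exact: wordsV_map.
apply/List.in_map_iff; exists S; split=> //; congr (FEx _ _ _).
have : forall a, List.In a G -> List.In a AA by move=> a; apply: MM_AA h2.
elim: (G) => [|a G' IH] //= aA; rewrite IH => [|b bG]; last by apply: aA; right.
congr (_ :: _); apply: eq_ren_atom => x xa; rewrite wren_map //.
by apply: AA_V xa; apply: aA; left.
Qed.

End Simulation.

(** * Existential positive theories determine simulations *)

Section Theories.
Variables (sg : vocabulary) (g : guarding) (V : seq nat).
Variables (AA : seq (atom sg)) (MM : seq (seq nat * seq (atom sg))).
Hypothesis AA_V : forall a, List.In a AA -> {subset atom_vars a <= V}.
Hypothesis MM_guard : forall xs G, List.In (xs, G) MM -> is_guard g xs G [::].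
Hypothesis MM_AA : forall xs G a, List.In (xs, G) MM -> List.In a G -> List.In a AA.
Implicit Types N : fin_structure sg.

(** Each pair to be covered is the image of a pair covered by the original guard. Guarding only asks
    for common membership in a conjunct, so [rho] may identify variables. *)
Lemma guard_ren xs (G : seq (atom sg)) rho ys zs : is_guard g xs G [::] ->
  (forall y, y \in ys -> exists2 x, x \in xs & y = rho x) ->
  (forall z, z \in zs -> exists2 x, live g xs G x & z = rho x) ->
  is_guard g ys (map (ren_atom rho) G) zs.
Proof.
move=> gG hy hz.
have lxs x : x \in xs -> live g xs G x.
  by move=> xx; apply: (live_guard gG); apply: (guard_xs gG xx).
have hyp z : z \in ys ++ conj_vars (map (ren_atom rho) G) ++ zs ->
  exists2 x, live g xs G x & z = rho x.
  rewrite !mem_cat => /or3P[/hy[x xx ->]|h|/hz//]; first by exists x => //; apply: lxs.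
  move: h; rewrite conj_vars_ren => /mapP[x xG ->]; exists x => //.
  exact: (live_guard gG).
have pair y z : y \in ys -> z \in ys ++ conj_vars (map (ren_atom rho) G) ++ zs ->
  exists a, [/\ List.In a G, y \in map rho (atom_vars a) & z \in map rho (atom_vars a)].
  move=> /hy[x xx ->] /hyp[x' lx' ->].
  have [a [h1 h2 h3]] := live_pair gG xx lx'.
  by exists a; rewrite !map_f.
clear lxs; case: g gG hy hz hyp pair => /=.
  case: G => [|a []] //= h hy hz _ _; rewrite atom_vars_ren all_cat.
  rewrite cats0 in h; move/allP: h => h.
  apply/andP; split; apply/allP => z /=.
    by move=> /hy[x /h /= xx ->]; rewrite map_f.
  by move=> /hz[x]; rewrite /live /= all_cat /= andbT => /andP[_ hx] ->; rewrite map_f.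
move=> _ _ _ _ pair; apply/allP => y yy; apply/allP => z zz.
have [a [h1 h2 h3]] := pair y z yy zz.
elim: (G) h1 => //= b G' IH [->|/IH->]; last by rewrite orbT.
by rewrite atom_vars_ren h2 h3.
Qed.

Lemma th_sim0 N N' (p : N -> option N') (e : assignment N) (e' : assignment N')
  (D : seq nat) j : {subset D <= V} ->
  (forall c c', p c = Some c' -> exists x, [/\ x \in D, e x = Some c & e' x = Some c']) ->
  (forall f, List.In f (cand g V AA MM j) -> {subset free_vars f <= D} ->
     holds e f -> holds e' f) -> sim0 AA p.
Proof.
move=> DV nmP th a aA d dp da.
(* [rho x] is a variable of [D] naming both the value of [x] and its image under [p]. The default
   [x] keeps [rho] inside [V] where no such name exists. *)
pose rho x := if d x is Some c then
  nth x D (find (fun y => (e y == Some c) && (e' y == p c)) D) else x.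
have rhoV : {in V, forall x, rho x \in V}.
  move=> x xV; rewrite /rho; case: (d x) => // c.
  case: (ltnP (find (fun y => (e y == Some c) && (e' y == p c)) D) (size D)) => h.
    by apply: DV; apply: mem_nth.
  by rewrite nth_default.
have nm x c : x \in atom_vars a -> d x = Some c ->
  [/\ rho x \in D, e (rho x) = Some c & e' (rho x) = p c].
  move=> xa E; have [c' Ec'] := dp _ _ xa E.
  have [y [yD E1 E2]] := nmP _ _ Ec'.
  have H : has (fun y => (e y == Some c) && (e' y == p c)) D.
    by apply/hasP; exists y => //; rewrite E1 E2 Ec' !eqxx.
  rewrite /rho E; split; first by rewrite mem_nth // -has_find.
    by case/andP: (nth_find x H) => /eqP h1 /eqP h2.
  by case/andP: (nth_find x H) => /eqP h1 /eqP h2.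
have : holds e' (FAtom (ren_atom rho a)).
  apply: th; first exact: cand_atom.
    move=> z /=; rewrite atom_vars_ren => /mapP[x xa ->].
    by have [c E] := atom_holds_def da xa; have [] := nm _ _ xa E.
  rewrite /=; apply/atom_holds_ren; apply: atom_holds_ext (da) => x xa.
  by have [c E] := atom_holds_def da xa; have [_ E1 _] := nm _ _ xa E; rewrite E /= E1.
move/atom_holds_ren; apply: atom_holds_ext => x xa /=.
have [c E] := atom_holds_def da xa; have [_ _ E1] := nm _ _ xa E.
by rewrite /pcomp E E1.
Qed.

(** [D] names the pairs of [p]. A move is described by a single existential formula: the renamed
    guard together with all candidates of the next lower level true of the values. A witness of this
    formula in [N'] is the answer, and it satisfies the induction hypothesis. *)
Lemma th_sim j N N' (p : N -> option N') (e : assignment N) (e' : assignment N')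
  (D : seq nat) : {subset D <= V} ->
  (forall c c', p c = Some c' -> exists x, [/\ x \in D, e x = Some c & e' x = Some c']) ->
  (forall f, List.In f (cand g V AA MM j) -> {subset free_vars f <= D} ->
     holds e f -> holds e' f) -> sim g V AA MM j p.
Proof.
elim: j N N' p e e' D => [|j IH] N N' p e e' D DV nmP th; split=> //;
  try exact: th_sim0 th.
move=> xs G d md dp; have [inM dV dG] := md.
have gG := MM_guard inM.
(* Retained values, then all values. A rebound variable whose value is also a retained one takes
   over the old name of that value. *)
pose S0 := [set c | has (fun z => (z \notin xs) && (d z == Some c)) V].
pose T := [set c | has (fun z => d z == Some c) V].
have TP x c : d x = Some c -> c \in T.
  by move=> E; rewrite inE; apply/hasP; exists x; rewrite ?E //; have [] := dV _ _ E.
have S0P x c : x \notin xs -> d x = Some c -> c \in S0.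
  move=> xx E; rewrite inE; apply/hasP; exists x; rewrite ?E ?xx ?eqxx //.
  by have [] := dV _ _ E.
have S0T : S0 \subset T.
  apply/subsetP => c; rewrite !inE => /hasP[x xV /andP[_ E]].
  by apply/hasP; exists x.
pose nm c := nth 0 D (find (fun y => (e y == Some c) && (e' y == p c)) D).
have nmS c : c \in S0 -> [/\ nm c \in D, e (nm c) = Some c & e' (nm c) = p c].
  rewrite inE => /hasP[x xV /andP[xx /eqP E]].
  have [c' Ec'] := dp _ _ xx E; have [y [yD E1 E2]] := nmP _ _ Ec'.
  have H : has (fun y => (e y == Some c) && (e' y == p c)) D.
    by apply/hasP; exists y => //; rewrite E1 E2 Ec' !eqxx.
  split; first by rewrite mem_nth // -has_find.
    by case/andP: (nth_find 0 H) => /eqP h1 /eqP h2.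
  by case/andP: (nth_find 0 H) => /eqP h1 /eqP h2.
pose names := [seq nm c | c <- enum S0].
(* The variables left for new values. They suffice: there are at most as many values as variables in
   [V], and each retained value occupies one name. *)
pose C := [seq x <- undup V | x \notin names].
have szC : #|T :\: S0| <= size C.
  have h1 : #|T| <= size (undup V).
    apply: (@leq_trans (size (pmap d (undup V)))); last first.
      by rewrite size_pmap count_size.
    apply: leq_trans (card_size _); apply: subset_leq_card; apply/subsetP => c.
    rewrite inE => /hasP[x xV /eqP E].
    by rewrite mem_pmap -E map_f // mem_undup.
  have h2 : size (undup V) <= #|S0| + size C.
    rewrite -(count_predC (mem names) (undup V)) /C size_filter leq_add2r.
    rewrite -size_filter cardE -(size_map nm); apply: uniq_leq_size.
      by rewrite filter_uniq ?undup_uniq.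
    by move=> x; rewrite mem_filter => /andP[].
  by rewrite cardsD (setIidPr S0T) leq_subLR; apply: leq_trans h2.
have uC : uniq C by rewrite filter_uniq ?undup_uniq.
have [nu [nuC nuI]] := fresh 0 uC szC.
have nuV c : c \in T :\: S0 -> nu c \in V.
  by move/nuC; rewrite mem_filter mem_undup => /andP[].
have nunm c c' : c \in T :\: S0 -> c' \in S0 -> nu c <> nm c'.
  move=> /nuC; rewrite mem_filter => /andP[/negP h _] cS E; apply: h.
  by rewrite E map_f // mem_enum.
pose name c := if c \in S0 then nm c else nu c.
pose xs' := [seq x <- V | x \in [seq nu c | c <- enum (T :\: S0)]].
have xsP y : y \in xs' -> exists2 c, c \in T :\: S0 & y = nu c.
  rewrite mem_filter => /andP[/mapP[c cT ->] _]; exists c => //.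
  by rewrite mem_enum in cT.
have nuxs c : c \in T :\: S0 -> nu c \in xs'.
  by move=> cT; rewrite mem_filter nuV // map_f // mem_enum.
have nmxs c : c \in S0 -> nm c \notin xs'.
  by move=> cS; apply/negP => /xsP[c' c'T /esym/(nunm _ _ c'T cS)].
pose e2 y := if [pick c in T :\: S0 | nu c == y] is Some c then Some c else e y.
have e2out y : y \notin xs' -> e2 y = e y.
  move=> yx; rewrite /e2; case: pickP => // c /andP[cT /eqP E].
  by case/negP: yx; rewrite -E; apply: nuxs.
have e2name c : c \in T -> e2 (name c) = Some c.
  move=> cT; rewrite /name; case: ifPn => cS.
    by rewrite e2out ?nmxs //; have [] := nmS _ cS.
  have cN : c \in T :\: S0 by rewrite inE cS.
  rewrite /e2; case: pickP => [c' /andP[c'T /eqP E]|/(_ c)]; last by rewrite cN eqxx.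
  by rewrite (nuI c' c).
pose rho x := if d x is Some c then name c else x.
have nameV c : c \in T -> name c \in V.
  move=> cT; rewrite /name; case: ifPn => cS; first by apply: DV; have [] := nmS _ cS.
  by apply: nuV; rewrite inE cS.
have rhoV : {in V, forall x, rho x \in V}.
  by move=> x xV; rewrite /rho; case E: (d x) => [c|] //; apply: nameV; apply: TP E.
pose D2 := [seq name c | c <- enum T].
(* All that the next level can say about the values of the move. *)
pose S := filter (fun f => `[< {subset free_vars f <= D2} /\ holds e2 f >])
  (cand g V AA MM j).
have freeS z : z \in free_vars (bigand S) -> z \in D2.
  by case/free_bigand => f /In_filter[_ /asboolP[h _]]; apply: h.
have D2live z : z \in D2 -> exists2 x, live g xs G x & z = rho x.
  case/mapP => c; rewrite mem_enum inE => /hasP[x xV /eqP E] ->.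
  by exists x; rewrite /rho ?E //; have [] := dV _ _ E.
have D2xs z : z \in D2 -> z \notin xs' -> z \in D.
  case/mapP => c; rewrite mem_enum => cT -> h; move: h; rewrite /name; case: ifPn => cS.
    by have [] := nmS _ cS.
  by rewrite nuxs // inE cS.
have conjD2 z : z \in conj_vars (map (ren_atom rho) G) -> z \in D2.
  rewrite conj_vars_ren => /mapP[x xG ->]; have [c E] := conj_holds_def dG xG.
  by rewrite /rho E map_f // mem_enum; apply: TP E.
have goodS : good g V j (bigand S).
  by apply: good_bigand => f /In_filter[h _]; apply: cand_good h.
have goodF : good g V j.+1 (FEx xs' (map (ren_atom rho) G) (bigand S)).
  case/and4P: goodS => a b c r; rewrite /good /= a b ltnS r !andbT !all_cat c !andbT /=.
  apply/and3P; split.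
  - apply: (guard_ren (xs := xs)) => // [y|z /freeS]; last exact: D2live.
    move=> /xsP[c0]; rewrite inE => /andP[cS cT] ->.
    move: (cT); rewrite inE => /hasP[x xV /eqP E]; exists x.
      by apply/negPn/negP => xx; case/negP: cS; apply: S0P E.
    by rewrite /rho E /name (negPf cS).
  - by apply/allP => y /xsP[c0 /nuV h ->].
  - apply/allP => z /conjD2 /mapP[c0]; rewrite mem_enum => cT ->.
    exact: nameV.
have inF := cand_ex AA_V MM_AA (In_subs _ V) inM rhoV (In_subs _ _) goodF.
have holdF : holds e (FEx xs' (map (ren_atom rho) G) (bigand S)).
  exists e2; split; first split=> [x xx|x /xsP[c cT ->]]; first exact: e2out.
    exists c; have := e2name c; rewrite inE in cT; case/andP: cT => cS cT.
    by rewrite /name (negPf cS); apply.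
  split; last by apply/holds_bigand => f /In_filter[_ /asboolP[]].
  apply/conj_holdsP => a /List.in_map_iff[b [<- bG]].
  move/conj_holdsP: dG => /(_ b bG) db.
  apply/atom_holds_ren; apply: atom_holds_ext (db) => x xb /=.
  have [c E] := atom_holds_def db xb; rewrite /rho E e2name //.
  exact: TP E.
have [|e2' [[out2 in2] [G2 S2]]] := th _ inF _ holdF.
  move=> z /=; rewrite mem_filter mem_cat => /andP[zx /orP[/conjD2|/freeS]] h; exact: D2xs.
(* The answer is read off the witness [e2'], each value through its name. *)
pose p2 c := if c \in T then e2' (name c) else None.
have p2S c : c \in S0 -> p2 c = p c.
  move=> cS; rewrite /p2 (subsetP S0T) // /name cS out2 ?nmxs //.
  by have [] := nmS _ cS.
exists p2; split.
- move=> x c _ E; have cT := TP _ _ E.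
  case: (boolP (c \in S0)) => cS.
    rewrite p2S //; move: cS; rewrite inE => /hasP[y yV /andP[yx /eqP Ey]].
    exact: dp yx Ey.
  by rewrite /p2 cT /name (negPf cS); apply: in2; apply: nuxs; rewrite inE cS.
- by move=> x c xx E; apply: p2S; apply: S0P E.
apply: (IH _ _ p2 e2 e2' D2).
- by move=> z /mapP[c]; rewrite mem_enum => cT ->; apply: nameV.
- move=> c c'; rewrite /p2; case: ifP => // cT E; exists (name c).
  by rewrite map_f ?mem_enum // e2name.
move=> f fc fD hf; move/holds_bigand: S2; apply.
by apply/In_filter; split=> //; apply/asboolP.
Qed.

End Theories.

(** * Unravelling along a simulation *)

Lemma all_some (T : Type) n (u : seq (option T)) : size u = n -> all isSome u ->
  exists t : n.-tuple T, u = map Some t.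
Proof.
move=> <-{n}; elim: u => [|[x|] u IH] //= => [_|/IH[t E]]; first by exists [tuple].
by exists [tuple of x :: t]; rewrite /= {1}E.
Qed.

Section Unravelling.
Variables (sg : vocabulary) (g : guarding) (V : seq nat).
Variables (AA : seq (atom sg)) (MM : seq (seq nat * seq (atom sg))).
Hypothesis MM_guard : forall xs G, List.In (xs, G) MM -> is_guard g xs G [::].
Hypothesis MM_AA : forall xs G a, List.In (xs, G) MM -> List.In a G -> List.In a AA.
Notation sim := (sim g V AA MM).
Notation move := (move g V MM).

Variables (P N' : fin_structure sg) (r : P -> option N') (rinv : N' -> option P).
Variables (m : nat) (keep : bool).
Hypothesis sim_r : sim m r.
Hypothesis rK : forall a y, r a = Some y -> rinv y = Some a.
Hypothesis keepT : keep -> sim m rinv.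
Hypothesis keepF : ~~ keep -> forall a, r a = None.

(* A node of the tree is the list of moves leading to it, last move first: an entry
   [(S, q)] keeps the set [S] of elements of the previous copy of [P] and continues the
   simulation with [q].  The copies of [P] at the nodes are glued along the kept
   elements; when [keep] holds, the root copy is moreover glued to a copy of [N'] along
   the partial injection [r]. *)
Definition entry : finType := ({set P} * {ffun P -> option N'})%type.

Definition node_map (w : seq entry) : P -> option N' :=
  if w is e :: _ then e.2 else r.

Fixpoint valid (w : seq entry) : Prop :=
  if w is e :: w' then
    [/\ valid w', forall a, a \in e.1 -> exists2 y, node_map w' a = Some y & e.2 a = Some y,
        sim (m - size w) e.2 & size w <= m]
  else True.

(** An element is recorded by its birth, the highest node where it occurs: [inr (w, a, y)] is the
    copy of [a] born at [w] and lying over [y], and a root element over [y] is identified with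
    [inl y]. Elements outside the domain of a node's map have no copy there. Bounding the depth by
    [m] keeps the type finite. *)
Definition raw : finType := (N' + (m.-bseq entry * P * N'))%type.

Fixpoint raw_elt (w : seq entry) (a : P) : option raw :=
  if w is e :: w' then
    if a \in e.1 then raw_elt w' a
    else if e.2 a is Some y then Some (inr (insub_bseq m w, a, y)) else None
  else if r a is Some y then Some (inl y) else None.

Definition raw_ok (q : raw) : Prop :=
  match q with
  | inl _ => keep
  | inr (w, a, y) => valid w /\ raw_elt w a = Some q
  end.

Definition unravelled : finType := {q : raw | `[< raw_ok q >]}.

Definition node_elt w a : option unravelled := obind insub (raw_elt w a).

(** Copies of [P] contribute only tuples matching an atom of [AA], since these are the ones that the
    maps of the nodes are known to preserve. *)
Definition unravel_interp (R : symbol sg) (t : (arity R).-tuple unravelled) : Prop :=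
  (keep /\ exists2 t' : (arity R).-tuple N', map val t = map inl t' & interp t') \/
  (exists w (vs : (arity R).-tuple nat) (e : assignment P), [/\ valid w, List.In (Rel vs) AA,
     atom_holds e (Rel vs) & map (pcomp (node_elt w) e) vs = map Some t]).

Definition unravelling : fin_structure sg :=
  @FinStructure sg unravelled (fun R t => `[< unravel_interp t >]).

Definition proj (q : unravelling) : N' :=
  match val q with inl y => y | inr (_, _, y) => y end.

Definition origin (q : unravelling) : option P :=
  match val q with inl y => rinv y | inr (_, a, _) => Some a end.

Definition level (q : raw) := if q is inr (w, _, _) then size w else 0.

Lemma valid_sim w : valid w -> sim (m - size w) (node_map w).
Proof. by case: w => [|e w] /=; [rewrite subn0|case]. Qed.

Lemma insub_bseqK w : size w <= m -> insub_bseq m w = w :> seq entry.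
Proof. by move=> h; rewrite /insub_bseq insubdK. Qed.

Lemma raw_elt_map w a y : valid w -> node_map w a = Some y ->
  exists2 q, raw_elt w a = Some q &
    [/\ raw_ok q, match q with inl y' => y' | inr (_, _, y') => y' end = y &
     match q with inl y' => rinv y' | inr (_, a, _) => Some a end = Some a].
Proof.
elim: w => [|e w IH] /=.
  move=> _ E; rewrite E; exists (inl y) => //; split=> //; last exact: rK.
  by case: (boolP keep) => // /keepF/(_ a); rewrite E.
move=> [vw hS hs hsz] E; case: ifP => aS.
  by apply: IH => //; have [y' E1 E2] := hS a aS; rewrite -E E2.
rewrite E; exists (inr (insub_bseq m (e :: w), a, y)) => //; split=> //=.
by rewrite insub_bseqK //= aS E.
Qed.

Lemma raw_elt_inr w a x : raw_elt w a = Some (inr x) -> 0 < size w.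
Proof. by case: w => //=; case: (r a). Qed.

Lemma raw_elt_None w a : valid w -> node_map w a = None -> raw_elt w a = None.
Proof.
case: w => [|e w] /=; first by move=> _ ->.
move=> [vw hS hs hsz] E; case: ifP => aS; last by rewrite E.
by have [y' E1 E2] := hS a aS; rewrite E in E2.
Qed.

Lemma node_elt_map w a y : valid w -> node_map w a = Some y ->
  exists2 q : unravelling, node_elt w a = Some q & proj q = y /\ origin q = Some a.
Proof.
move=> vw E; have [q Eq [h1 h2 h3]] := raw_elt_map vw E.
have ok : `[< raw_ok q >] by apply/asboolP.
by exists (Sub q ok); rewrite /node_elt ?Eq /= ?(insubT (fun q => `[< raw_ok q >]) ok).
Qed.

Lemma node_eltP w a q : valid w -> node_elt w a = Some q ->
  node_map w a = Some (proj q) /\ origin q = Some a.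
Proof.
move=> vw E; case Ep : (node_map w a) => [y|].
  by have [q' E' [<- h]] := node_elt_map vw Ep; move: E'; rewrite E => -[->].
by rewrite /node_elt raw_elt_None in E.
Qed.

Lemma node_elt_raw w a (q : unravelling) : node_elt w a = Some q -> raw_elt w a = Some (val q).
Proof.
rewrite /node_elt; case: (raw_elt w a) => //= q'; case: insubP => //= u _ <- [->//].
Qed.

Lemma raw_node_elt w a (q : unravelling) : raw_elt w a = Some (val q) -> node_elt w a = Some q.
Proof. by rewrite /node_elt => ->; rewrite /= valK. Qed.

Lemma node_elt_atom w a (d : assignment P) : valid w -> List.In a AA ->
  into (node_map w) d (mem (atom_vars a)) -> atom_holds d a ->
  atom_holds (pcomp (node_elt w) d : assignment unravelling) a.
Proof.
move=> vw; case: a => [R vs|x y] /= aA dp.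
  move=> dR; have [s [Es Is]] := dR.
  have [|t Et] := @all_some unravelled (arity R) (map (pcomp (node_elt w) d) vs) (size_tuple _).
    apply/allP => _ /mapP[x xv ->].
    have : d x \in map Some s by rewrite -Es map_f.
    case/mapP => c _ E; rewrite /pcomp E /=.
    by have [y /(node_elt_map vw)[q -> _]] := dp x c xv E.
  exists t; split=> //; apply/asboolP; right.
  by exists w, vs, d; split.
case=> c [E1 E2]; have [|y' /(node_elt_map vw)[q Eq _]] := dp x c _ E1.
  by rewrite /= inE eqxx.
by exists q; rewrite /pcomp E1 E2.
Qed.

(** A move in [P] is answered by going to a child of [w] where the retained elements stay glued and
    the others become new copies, placed over the answer given by the map of [w]. The depth bound
    limits the number of rounds. *)
Lemma sim_node_elt j w : valid w -> j + size w <= m -> sim j (node_elt w : P -> option unravelling).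
Proof.
have s0 w' : valid w' -> sim0 AA (node_elt w' : P -> option unravelling).
  move=> vw a aA d dp da; apply: node_elt_atom => // x c xa E.
  by have [q /(node_eltP vw)[-> _]] := dp x c xa E; exists (proj q).
elim: j w => [|j IH] w vw le; split; try exact: s0; first by [].
move=> xs G d md dp.
have lt : size w < m by apply: leq_trans le; rewrite addSn ltnS leq_addl.
have Em : m - size w = (m - (size w).+1).+1 by rewrite subnSK.
have := valid_sim vw; rewrite Em => -[_ /(_ xs G d md)].
case=> [x c xx E|p2 [h1 h2 h3]].
  by have [q /(node_eltP vw)[-> _]] := dp x c xx E; exists (proj q).
pose S := [set c | has (fun z => (z \notin xs) && (d z == Some c)) V].
pose w' : seq entry := (S, finfun p2) :: w.
have vw' : valid w'.
  split=> //=.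
    move=> a; rewrite inE => /hasP[x xV /andP[xx /eqP E]].
    have [q /(node_eltP vw)[Ea _]] := dp x a xx E; exists (proj q) => //.
    by rewrite ffunE (h2 x).
  by apply: sim_sub h3 => x y; rewrite ffunE.
exists (node_elt w'); split.
- move=> x c _ E; have [y Ey] := h1 x c isT E.
  have [|q Eq _] := @node_elt_map w' c y vw'; first by rewrite /= ffunE.
  by exists q.
- move=> x c xx E; rewrite /node_elt /=.
  suff -> : c \in S by [].
  rewrite inE; apply/hasP; exists x; last by rewrite xx E eqxx.
  by case: md => _ /(_ _ _ E)[].
- by apply: IH => //=; rewrite addnS -addSn.
Qed.

(** On a tuple coming from a node, [proj] acts as the map of that node, which preserves the atoms of
    [AA]; on the root copy of [N'] it is the identity. *)
Lemma hom_proj : is_hom proj.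
Proof.
move=> R t /asboolP[[k [t' Et It]]|[w [vs [e [vw vA eR Et]]]]].
  rewrite (_ : map_tuple proj t = t') //; apply: val_inj => /=.
  rewrite (eq_map (g := (fun q => match q with inl y => y | inr (_, _, y) => y end) \o val)) //.
  by rewrite map_comp Et -map_comp map_id.
have h : into (node_map w) e (mem (atom_vars (Rel vs))).
  move=> x c xv E.
  have : pcomp (node_elt w) e x \in map Some t by rewrite -Et map_f.
  case/mapP => q _; rewrite /pcomp E /= => /(node_eltP vw)[-> _].
  by exists (proj q).
have [s [Es Is]] := sim_sim0 (valid_sim vw) vA h eR.
rewrite (_ : map_tuple proj t = s) //; apply: val_inj => /=.
apply: (inj_map (@Some_inj _)); rewrite -Es.
transitivity (map (omap proj) (map Some t)); first by rewrite -!map_comp.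
rewrite -Et -map_comp.
apply/eq_in_map => x xv /=.
have : pcomp (node_elt w) e x \in map Some t by rewrite -Et map_f.
by case/mapP => q _; rewrite /pcomp; case: (e x) => //= c E;
  rewrite E; have [-> _] := node_eltP vw E.
Qed.

Definition root_emb (k : keep) (y : N') : unravelling :=
  Sub (inl y : raw) (introT (asboolP _) (k : raw_ok (inl y))).

Lemma hom_root_emb k : is_hom (root_emb k).
Proof.
move=> R t It; apply/asboolP; left; split=> //; exists t => //=.
by rewrite -map_comp; apply: eq_map.
Qed.

Definition in_node w (q : unravelling) : bool := [exists a, node_elt w a == Some q].
Definition together (q q' : unravelling) :=
  (keep /\ level (val q) = 0 /\ level (val q') = 0) \/
  (exists w, [/\ valid w, in_node w q & in_node w q']).

Lemma in_node_level w u q : valid (u ++ w) -> in_node (u ++ w) q -> level (val q) <= size w ->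
  in_node w q.
Proof.
elim: u => [|e u IH] //= vu.
case/existsP => a /eqP /node_elt_raw /=; case: ifP => aS.
  move=> /raw_node_elt E; apply: IH; first by case: vu.
  by apply/existsP; exists a; apply/eqP.
case: (e.2 a) => // y [<-]; rewrite /level insub_bseqK; last by case: vu.
by rewrite /= size_cat -addSn -[X in _ <= X]add0n leq_add2r.
Qed.

Lemma in_node_birth w q b a y : valid w -> in_node w q -> val q = inr (b, a, y) ->
  exists u, w = u ++ b.
Proof.
elim: w => [|e w IH] vw /existsP[c /eqP/node_elt_raw] /=.
  by move=> E Eq; move: E; rewrite Eq; case: (r c).
case: ifP => cS.
  move=> E Eq; have [||u ->] := IH _ _ Eq; first by case: vw.
    by apply/existsP; exists c; apply/eqP; apply: raw_node_elt.
  by exists (e :: u).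
case: (e.2 c) => // y' [E] Eq; move: E; rewrite Eq => -[<- _ _].
by exists [::]; rewrite insub_bseqK //; case: vw.
Qed.

Lemma together_refl q : together q q.
Proof.
case E: (val q) => [y|[[w a] y]].
  left; have /asboolP := valP q; rewrite E /= => k; by [].
have /asboolP := valP q; rewrite E /= => -[vw Ea].
by right; exists w; split=> //; apply/existsP; exists a; apply/eqP/raw_node_elt; rewrite E.
Qed.

(* Each element appears on a subtree with a well-defined highest node, hence the Helly
   property: pairwise coexisting elements coexist in a node. *)
Lemma helly (qs : seq unravelling) : {in qs &, forall q q', together q q'} ->
  (exists2 w, valid w & {in qs, forall q, in_node w q}) \/
  (keep /\ {in qs, forall q, level (val q) = 0}).
Proof.
case: qs => [|q0 qs] tog; first by left; exists [::].
set s := q0 :: qs in tog *.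
(* Take a member born as deep as possible. Another member shares a node with it, below or at its
   birth node, and being born no deeper it already occurs at that birth node. *)
case: (@arg_maxnP unravelling q0 (mem s) (fun q => level (val q))); first exact: mem_head.
move=> q qsin qmax0.
have qmax (q' : unravelling) : q' \in s -> level (val q') <= level (val q) by apply: qmax0.
case E: (val q) => [y|[[b a] y]].
  right; split; first by have /asboolP := valP q; rewrite E.
  by move=> q' /qmax; rewrite E /= leqn0 => /eqP.
left; have /asboolP := valP q; rewrite E /= => -[vb Ea]; exists b => // q' q'in.
have lb : level (val q) > 0.
  by rewrite E /=; apply: raw_elt_inr Ea.
have [[_ [h _]]|[w [vw i1 i2]]] := tog q q' qsin q'in; first by rewrite h in lb.
have [u Eu] := in_node_birth vw i1 E; rewrite Eu in vw i2.
by apply: in_node_level vw i2 _; have := qmax _ q'in; rewrite E.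
Qed.

Lemma rel_together R (t : (arity R).-tuple unravelled) : unravel_interp t ->
  {in t &, forall q q', together q q'}.
Proof.
case=> [[k [t' Et _]]|[w [vs [e [vw _ _ Et]]]]] q q' qt q't.
  left; split=> //; have : val q \in map inl t' by rewrite -Et map_f.
  have : val q' \in map inl t' by rewrite -Et map_f.
  by move=> /mapP[? _ ->] /mapP[? _ ->].
right; exists w; split=> //; apply/existsP.
  have : Some q \in map Some t by rewrite map_f.
  by rewrite -Et => /mapP[x _]; rewrite /pcomp; case: (e x) => //= c E; exists c; rewrite -E.
have : Some q' \in map Some t by rewrite map_f.
by rewrite -Et => /mapP[x _]; rewrite /pcomp; case: (e x) => //= c E; exists c; rewrite -E.
Qed.

Lemma atom_together (d : assignment unravelling) a x x' q q' : atom_holds d a ->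
  x \in atom_vars a -> x' \in atom_vars a -> d x = Some q -> d x' = Some q' ->
  together q q'.
Proof.
case: a => [R vs|y y'] da xa xa' Ex Ex'; last first.
  by rewrite (Eq_vals da xa xa' Ex Ex'); apply: together_refl.
case: da => t [Et /asboolP It].
by apply: (rel_together It); [apply: map_Some_in Et xa Ex|apply: map_Some_in Et xa' Ex'].
Qed.

Definition node_inv w (q : unravelling) : option P := if in_node w q then origin q else None.

Lemma node_inv_def w q : valid w -> in_node w q ->
  exists a, [/\ node_inv w q = Some a, origin q = Some a & node_map w a = Some (proj q)].
Proof.
move=> vw iq; rewrite /node_inv iq; case/existsP: iq => a /eqP /(node_eltP vw)[h1 h2].
by exists a.
Qed.

Lemma origin_inl q y : val q = inl y -> origin q = rinv (proj q).
Proof. by rewrite /origin /proj => ->. Qed.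

(** A related tuple stems from [N'], where [rinv] preserves the atom, or from some node, possibly
    not [w], where it copies a related tuple of [P]. The origin of an element is the same at all
    nodes, so the latter tuple is the required image. *)
Lemma sim0_node_inv w : valid w -> sim0 AA (node_inv w).
Proof.
move=> vw a aA d dp; case: a aA dp => [R vs|x y] aA dp /=; last first.
  case=> c [E1 E2]; have [|b Eb] := dp x c _ E1; first by rewrite /= inE eqxx.
  by exists b; rewrite /pcomp E1 E2.
case=> t [Et /asboolP It].
have zt q : q \in t -> node_inv w q = origin q /\ exists a, origin q = Some a.
  move=> qt; have : Some q \in map d vs by rewrite Et map_f.
  case/mapP => x xv /esym E; have [b] := dp x q xv E; rewrite /node_inv.
  by case: ifP => // _ ->; split=> //; exists b.
case: (It) => [[k [t' Et' It']]|[w2 [vs2 [e [vw2 vA [s [Es Is]] Et2]]]]].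
  have inl_t q : q \in t -> exists y, val q = inl y.
    move=> qt; have : val q \in map inl t' by rewrite -Et' map_f.
    by case/mapP => y _ E; exists y.
  have hrho : atom_holds (pcomp (fun x => Some (proj x)) d) (Rel vs).
    by apply: atom_holds_hom hom_proj _; exists t; split=> //; apply/asboolP.
  have dp' : into rinv (pcomp (fun x => Some (proj x)) d) (mem (atom_vars (Rel vs))).
    move=> x c xv; rewrite /pcomp; case E: (d x) => [q|] //= [<-].
    have qt : q \in t := map_Some_in Et xv E.
    have [y Ey] := inl_t q qt; rewrite -(origin_inl Ey).
    by have [_] := zt q qt.
  have := sim_sim0 (keepT k) aA dp' hrho.
  apply: atom_holds_ext => x xv; rewrite /pcomp.
  have : d x \in map Some t by rewrite -Et map_f.
  case/mapP => q qt ->; rewrite /=.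
  by have [y Ey] := inl_t q qt; have [-> _] := zt q qt; rewrite (origin_inl Ey).
exists s; split=> //.
rewrite (eq_map (g := obind (node_inv w) \o d)) // map_comp Et.
have -> : map (obind (node_inv w)) (map Some t) = map (obind origin) (map Some t).
  by rewrite -!map_comp; apply/eq_in_map => q /zt[].
rewrite -Et2 -map_comp -Es; apply/eq_in_map => x xv /=.
have : pcomp (node_elt w2) e x \in map Some t by rewrite -Et2 map_f.
case/mapP => q _; rewrite /pcomp; case: (e x) => //= c E.
by rewrite E /=; have [] := node_eltP vw2 E.
Qed.

(* The answer may come from another node than [w], found by [helly]; this is where the
   pairwise covering property of the guards is used. *)
Lemma sim_node_inv j w : j <= m -> valid w -> sim j (node_inv w).
Proof.
elim: j w => [|j IH] w le vw; split; try exact: sim0_node_inv; first by [].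
move=> xs G d md dp; have [inM dV dG] := md.
have inw_ret x q : x \notin xs -> d x = Some q -> in_node w q.
  by move=> xx E; have [b] := dp x q xx E; rewrite /node_inv; case: ifP.
have tog : {in pmap d V &, forall q q', together q q'}.
  have pair x x' q q' : x \in xs -> d x = Some q -> d x' = Some q' -> together q q'.
    move=> xx E E'; have [_ lx'] := dV _ _ E'.
    have [a [aG xa xa']] := live_pair (MM_guard inM) xx lx'.
    by apply: atom_together xa xa' E E'; move/conj_holdsP: dG; apply.
  move=> q q'; rewrite !mem_pmap => /mapP[x xV /esym E] /mapP[x' xV' /esym E'].
  case: (boolP (x \in xs)) => xx; first exact: pair xx E E'.
  case: (boolP (x' \in xs)) => xx'.
    have [[k [h1 h2]]|[w' [h1 h2 h3]]] := pair _ _ _ _ xx' E' E; first by left.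
    by right; exists w'.
  by right; exists w; split=> //; [apply: inw_ret E|apply: inw_ret E'].
have inV x q : d x = Some q -> q \in pmap d V.
  by move=> E; rewrite mem_pmap -E map_f //; have [] := dV _ _ E.
(* If the values share a node, its inverse is the answer. Otherwise they lie in the root copy of
   [N'], where [origin] is [rinv] after [proj] and the simulation [rinv] answers. *)
have [[w2 vw2 all2]|[k all0]] := helly tog.
  exists (node_inv w2); split; last exact: IH (ltnW le) vw2.
    move=> x q _ E; have [a [Ea _ _]] := node_inv_def vw2 (all2 _ (inV _ _ E)).
    by exists a.
  move=> x q xx E; rewrite /node_inv (all2 _ (inV _ _ E)).
  by rewrite (inw_ret x).
have cmpq x q : d x = Some q -> origin q = rinv (proj q).
  move=> /inV/all0; case Eq: (val q) => [y|[[b a] y]] /=; first by move=> _; apply: origin_inl Eq.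
  by have /asboolP := valP q; rewrite Eq /= => -[_ /raw_elt_inr]; case: (size b).
have sm : sim j.+1 (fun q => obind rinv (Some (proj q))).
  apply: sim_comp => //; first exact: sim_hom hom_proj.
  exact: sim_leq le (keepT k).
have [|p2 [h1 h2 h3]] := sm.2 xs G d md.
  move=> x q xx E /=; rewrite -(cmpq x q E).
  by have [a [_ Ea _]] := node_inv_def vw (inw_ret x q xx E); exists a.
exists p2; split=> // x q xx E; rewrite (h2 x) //= -(cmpq x q E).
by rewrite /node_inv (inw_ret x).
Qed.

End Unravelling.

(** * Finite covers realising all compatible local configurations *)

Section Cover.
Variables (sg : vocabulary) (g : guarding) (V : seq nat).
Variables (AA : seq (atom sg)) (MM : seq (seq nat * seq (atom sg))).
Hypothesis AA_V : forall a, List.In a AA -> {subset atom_vars a <= V}.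
Hypothesis MM_guard : forall xs G, List.In (xs, G) MM -> is_guard g xs G [::].
Hypothesis MM_AA : forall xs G a, List.In (xs, G) MM -> List.In a G -> List.In a AA.
Notation sim := (sim g V AA MM).

Variables (k : nat) (A0 B : fin_structure sg).

Definition num_vars_V := size (undup V).
Definition var_bound := (foldr maxn 0 V).+1.
(** Indices separate elements of a realisation over the same element of [B]. Twice the number of
    variables leaves room for retained keys and new elements together; one more index makes the type
    inhabited in all cases. *)
Definition key_index : finType := 'I_((num_vars_V + num_vars_V).+1).
Definition cover_key : finType := (B * key_index)%type.
Notation K := cover_key.
Definition candidates := cand g V AA MM k.

Definition theory_at (N : fin_structure sg) (e : assignment N) : {set 'I_(size candidates)} :=
  [set i | `[< holds e (nth FTrue candidates (val i)) >]].

Notation key_assignment := {ffun 'I_var_bound -> option K}.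
Definition assign_of (e : key_assignment): nat -> option K :=
  fun x => obind (fun i => e i) (insub x).
Definition key_assign (e : nat -> option K) : key_assignment := [ffun i => e (val i)].

Definition restr (I : {set K}) (T : Type) (t : K -> option T) kap :=
  if kap \in I then t kap else None.

Notation State := {ffun key_assignment -> {set 'I_(size candidates)}}.
(** The theory of the family [t] under all assignments of keys to variables. Variables are bounded
    by [var_bound] so that states form a finite type and can be encoded by hashes. *)
Definition state (N : fin_structure sg) (t : K -> option N) : State :=
  [ffun e => theory_at (pcomp t (assign_of e))].
(** Computed from the state alone, so that states of different structures can be compared on a
    common set of keys. *)
Definition restr_state (I : {set K}) (s : State) : State :=
  [ffun e : key_assignment => s [ffun i => obind (restr I Some) (e i)]].

Lemma V_bound x : x \in V -> x < var_bound.
Proof.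
rewrite /var_bound ltnS; elim: V => //= y s IH; rewrite inE => /orP[/eqP->|/IH h].
  exact: leq_maxl.
by apply: leq_trans h _; apply: leq_maxr.
Qed.

Lemma assign_ofK e x : x < var_bound -> assign_of (key_assign e) x = e x.
Proof.
move=> h; rewrite /assign_of /key_assign.
by case: insubP => [i _ E|]; rewrite ?h //= ffunE E.
Qed.

Lemma assign_of_some e x kap : assign_of (key_assign e) x = Some kap -> e x = Some kap.
Proof. by rewrite /assign_of /key_assign; case: insubP => //= i _ E; rewrite ffunE E. Qed.

Lemma restr_stateE I (N : fin_structure sg) (t : K -> option N) :
  restr_state I (state t) = state (restr I t).
Proof.
apply/ffunP => e; rewrite !ffunE; congr theory_at; apply: funext => x.
rewrite /pcomp /assign_of; case: (insub x) => //= i; rewrite ffunE.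
by case: (e i) => //= kap; rewrite /restr; case: ifP.
Qed.

Lemma restr_restr (I I' : {set K}) (T : Type) (t : K -> option T) : I' \subset I ->
  restr I' (restr I t) = restr I' t.
Proof.
move=> sub; apply: funext => kap; rewrite /restr; case: ifP => // /(subsetP sub) h.
by rewrite h.
Qed.

Lemma nth_candidates (i : 'I_(size candidates)) :
  List.In (nth FTrue candidates i) candidates.
Proof.
elim: candidates (val i) (ltn_ord i) => //= f C IH [|n]; first by left.
by move=> lt; right; apply: IH.
Qed.

Lemma theory_at_holds (N N2 : fin_structure sg) (e : assignment N) (e2 : assignment N2) f :
  theory_at e = theory_at e2 -> List.In f candidates -> holds e f -> holds e2 f.
Proof.
move=> E fC hf.
have [i [ilt Ei]] : exists i, i < size candidates /\ nth FTrue candidates i = f.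
  elim: candidates fC => //= f' C IH [->|/IH[i [h1 h2]]]; first by exists 0.
  by exists i.+1.
have : Ordinal ilt \in theory_at e2.
  by rewrite -E inE; apply/asboolP; rewrite /= Ei.
by rewrite inE => /asboolP; rewrite /= Ei.
Qed.

Lemma agree_holds I (N N2 : fin_structure sg) (t : K -> option N) (t2 : K -> option N2)
  (e : nat -> option K) f : restr_state I (state t) = restr_state I (state t2) ->
  (forall x kap, e x = Some kap -> kap \in I) ->
  List.In f candidates -> holds (pcomp t (assign_of (key_assign e))) f ->
  holds (pcomp t2 (assign_of (key_assign e))) f.
Proof.
move=> E eI; apply: theory_at_holds; move: E.
rewrite !restr_stateE => /ffunP/(_ (key_assign e)).
rewrite !ffunE.
have H (N' : fin_structure sg) (t' : K -> option N') :
  pcomp (restr I t') (assign_of (key_assign e)) = pcomp t' (assign_of (key_assign e)).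
  apply: funext => x; rewrite /pcomp; case Ex : (assign_of (key_assign e) x) => [kap|] //=.
  by rewrite /restr (eI x) //; apply: assign_of_some.
by rewrite !H.
Qed.

(** The successor makes the target a cyclic group, in which hashes can be added and subtracted. *)
Definition code (s : State) : 'I_(#|State|.+1) := widen_ord (leqnSn _) (enum_rank s).

Lemma code_inj : injective code.
Proof.
move=> s s' E; apply: enum_rank_inj; apply: val_inj.
by have := congr1 val E.
Qed.

(* The hash of a vertex has one value per set [I] of keys; the values in column [I],
   summed over vertices with key set [I], encode the theory [state] of these keys. *)
Definition hashed_key : finType := (K * {ffun {set K} -> 'I_(#|State|.+1)})%type.

Notation X := hashed_key.

Definition empty_sim (N N' : fin_structure sg) := sim k (fun _ : N => None : option N').

(* A local configuration: some structure over [B], equivalent to [A0] in the k-round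
   game from the empty position, whose elements [t kap] lie over [kap.1]. *)
Definition realises (I : {set K}) (N : fin_structure sg) (t : K -> option N) : Prop :=
  exists h : N -> B, [/\ is_hom h, forall kap, (kap \in I) = isSome (t kap),
    forall kap x, t kap = Some x -> h x = kap.1,
    forall kap kap' x, t kap = Some x -> t kap' = Some x -> kap = kap'
    & empty_sim A0 N /\ empty_sim N A0].

Definition keys (T : {set X}) : {set K} := [set x.1 | x in T].
Definition hash (T : {set X}) : 'I_(#|State|.+1) := (\sum_(x in T) x.2 (keys T))%R.

(** Every nonempty subset encodes by its hash the theory of its own keys. The empty set is exempt
    because its hash is the empty sum, whatever the structure. *)
Definition typedby (T : {set X}) (N : fin_structure sg) (t : K -> option N) : Prop :=
  [/\ {in T &, injective fst}, realises (keys T) t &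
   forall T' : {set X}, T' \subset T -> T' != set0 ->
     hash T' = code (restr_state (keys T') (state t))].

Definition typed (T : {set X}) : Prop :=
  exists (N : fin_structure sg) (t : K -> option N), typedby T t.

Lemma keysS (T T' : {set X}) : T' \subset T -> keys T' \subset keys T.
Proof. exact: imsetS. Qed.

Lemma typedby_sub (T T' : {set X}) (N : fin_structure sg) (t : K -> option N) : T' \subset T ->
  typedby T t -> typedby T' (restr (keys T') t).
Proof.
move=> sub [inj [h [h1 h2 h3 h4 h5]] hs]; split.
- by move=> x y xT yT; apply: inj; apply: (subsetP sub).
- exists h; split=> //.
  + move=> kap; rewrite /restr; case: ifP => // kT; symmetry.
    by rewrite -h2; apply: (subsetP (keysS sub)).
  + by move=> kap x; rewrite /restr; case: ifP => // _; apply: h3.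
  + by move=> kap kap' x; rewrite /restr; case: ifP => // _ E; case: ifP => // _; apply: h4.
- move=> T2 sub2 ne; rewrite hs //; last exact: subset_trans sub2 sub.
  by rewrite !restr_stateE restr_restr //; apply: keysS.
Qed.

Lemma typed_sub (T T' : {set X}) : T' \subset T -> typed T -> typed T'.
Proof. by move=> sub [N [t h]]; exists N, (restr (keys T') t); apply: typedby_sub h. Qed.

(** Both states are decoded from the hash of [U0], which depends on [U0] alone. *)
Lemma agree (T T2 U0 : {set X}) (N N2 : fin_structure sg)
  (t : K -> option N) (t2 : K -> option N2) :
  typedby T t -> typedby T2 t2 -> U0 \subset T -> U0 \subset T2 -> U0 != set0 ->
  restr_state (keys U0) (state t) = restr_state (keys U0) (state t2).
Proof.
by move=> [_ _ h1] [_ _ h2] s1 s2 ne; apply: code_inj; rewrite -h1 // -h2.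
Qed.

Lemma empty_sim_trans (N1 N2 N3 : fin_structure sg) :
  empty_sim N1 N2 -> empty_sim N2 N3 -> empty_sim N1 N3.
Proof. by move=> h1 h2; have := sim_comp MM_AA h1 h2. Qed.

Lemma typedby_empty_sim (T T2 : {set X}) (N N2 : fin_structure sg) (t : K -> option N)
  (t2 : K -> option N2) : typedby T t -> typedby T2 t2 -> empty_sim N N2.
Proof.
move=> [_ [h [_ _ _ _ [_ s1]]] _] [_ [h2 [_ _ _ _ [s2 _]]] _].
exact: empty_sim_trans s1 s2.
Qed.

(** The atom is itself a candidate, so its truth belongs to the theory encoded by the common
    vertices. *)
Lemma transfer_atom (T T2 : {set X}) (N N2 : fin_structure sg) (t : K -> option N)
  (t2 : K -> option N2) a (e : nat -> option K) :
  typedby T t -> typedby T2 t2 -> List.In a AA ->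
  (forall x kap, x \in atom_vars a -> e x = Some kap -> kap \in keys (T :&: T2)) ->
  atom_holds (pcomp t e) a -> atom_holds (pcomp t2 e) a.
Proof.
move=> tT tT2 aA eI ha.
(* Without common vertices the atom has no variables at all, and the simulation from the empty
   position preserves it. *)
case: (eqVneq (T :&: T2) set0) => [E0|ne].
  have e0 x : x \in atom_vars a -> False.
    move=> xa; have [c] := atom_holds_def ha xa; rewrite /pcomp.
    case E: (e x) => [kap|] //= _; have := eI x kap xa E.
    by rewrite E0 /keys imset0 inE.
  have [s0 _] : sim0 AA (fun _ : N => None : option N2) /\ True.
    by split=> //; apply: sim_sim0 (typedby_empty_sim tT tT2).
  have := s0 a aA _ (fun x _ xa _ => False_ind _ (e0 x xa)) ha.
  by apply: atom_holds_ext => x xa; case: (e0 x xa).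
have E := agree tT tT2 (subsetIl _ _) (subsetIr _ _) ne.
pose e1 x := if x \in atom_vars a then e x else None.
have ee (M : fin_structure sg) (u : K -> option M) :
  {in atom_vars a, pcomp u (assign_of (key_assign e1)) =1 pcomp u e}.
  move=> x xa; rewrite /pcomp assign_ofK; first by rewrite /e1 xa.
  by apply: V_bound; apply: AA_V xa.
have := @agree_holds _ _ _ _ _ e1 (FAtom a) E.
move=> H; apply: atom_holds_ext (ee _ t2) _; apply: H.
- by move=> x kap; rewrite /e1; case: ifP => // xa; apply: eI xa.
- have := cand_atom g MM AA_V k (rho := id) (fun x h => h) aA.
  rewrite (_ : ren_atom id a = a) //; case: (a) => //= R vs.
    by congr Rel; apply: val_inj; rewrite /= map_id.
by apply: atom_holds_ext ha => x xa; rewrite ee.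
Qed.

(** The common keys are few enough to be named by distinct variables of [V]; the theory they share
    in both realisations then yields a simulation by [th_sim]. *)
Lemma agree_sim (T T2 U0 : {set X}) (N N2 : fin_structure sg) (t : K -> option N)
  (t2 : K -> option N2) (p : N -> option N2) :
  typedby T t -> typedby T2 t2 -> U0 \subset T -> U0 \subset T2 -> #|U0| <= num_vars_V ->
  (forall x y, p x = Some y ->
     exists kap, [/\ kap \in keys U0, t kap = Some x & t2 kap = Some y]) ->
  sim k p.
Proof.
move=> tT tT2 s1 s2 le pP.
case: (eqVneq U0 set0) => [E0|ne].
  apply: sim_sub (typedby_empty_sim tT tT2) => x y /pP[kap []].
  by rewrite E0 /keys imset0 inE.
have E := agree tT tT2 s1 s2 ne.
have le' : #|keys U0| <= num_vars_V by apply: leq_trans le; apply: leq_imset_card.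
have [nu [nuV nuI]] := fresh 0 (undup_uniq V) le'.
pose e x := [pick kap in keys U0 | nu kap == x].
have eK kap : kap \in keys U0 -> e (nu kap) = Some kap.
  move=> kU; rewrite /e; case: pickP => [kap' /andP[kU' /eqP Ek]|/(_ kap)].
    by rewrite (nuI kap' kap).
  by rewrite kU eqxx.
apply: (th_sim AA_V MM_guard MM_AA (e := pcomp t (assign_of (key_assign e)))
  (e' := pcomp t2 (assign_of (key_assign e))) (D := undup V)).
- by move=> x; rewrite mem_undup.
- move=> x y /pP[kap [kU h1 h2]]; exists (nu kap); split; first exact: nuV.
    by rewrite /pcomp assign_ofK ?eK //; apply: V_bound; rewrite -mem_undup; apply: nuV.
  by rewrite /pcomp assign_ofK ?eK //; apply: V_bound; rewrite -mem_undup; apply: nuV.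
move=> f fC _; apply: agree_holds E _ fC => x kap.
by rewrite /e; case: pickP => // kap' /andP[h _] [<-].
Qed.

Definition coloured_key : finType := (X * {ffun {set X} -> X})%type.
Notation Y := coloured_key.

(* The colour [y.2 c] ranges over a set of size [#|c|.-1], so that an untyped
   set [c] cannot be the projection of a set that is pairwise hyper. *)
Definition colour_ok (U : {set Y}) := forall c : {set X}, ~ typed c ->
  forall y, y \in U -> y.1 \in c ->
  [/\ y.2 c \in c, Some (y.2 c) != [pick x in c] &
   forall y', y' \in U -> y'.1 \in c -> y.2 c = y'.2 c -> y = y'].

Definition base (U : {set Y}) : {set X} := [set y.1 | y in U].

Definition hyper (U : {set Y}) : Prop :=
  [/\ {in U &, injective fst}, typed (base U) & colour_ok U].

Lemma hyper_sub (U U' : {set Y}) : U' \subset U -> hyper U -> hyper U'.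
Proof.
move=> sub [h1 h2 h3]; split.
- by move=> x y xU yU; apply: h1; apply: (subsetP sub).
- by apply: typed_sub h2; apply: imsetS.
- move=> c nc y yU yc; have [c1 c2 c3] := h3 c nc y (subsetP sub _ yU) yc.
  by split=> // y' yU'; apply: c3; apply: (subsetP sub).
Qed.

(* An untyped set cannot be injectively coloured with one colour fewer than its size. *)
Lemma hyper_pairs (U : {set Y}) : typed set0 ->
  (forall y y', y \in U -> y' \in U -> exists U', [/\ hyper U', y \in U' & y' \in U']) ->
  hyper U.
Proof.
move=> ty0 prs.
have inj : {in U &, injective fst}.
  by move=> y y' yU yU'; have [U' [[h _ _] i1 i2]] := prs y y' yU yU'; apply: h.
have col : colour_ok U.
  move=> c nc y yU yc; have [U' [[_ _ h] i1 _]] := prs y y yU yU.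
  have [h1 h2 _] := h c nc y i1 yc; split=> // y' yU' yc' E.
  have [U2 [[_ _ h'] j1 j2]] := prs y y' yU yU'.
  by have [_ _ h3] := h' c nc y j1 yc; apply: h3.
split=> //; apply: contrapT => nty.
case: (set_0Vmem U) => [E0|[y0 y0U]].
  by apply: nty; rewrite E0 /base imset0.
have yc y : y \in U -> y.1 \in base U by move=> yU; apply: imset_f.
have Uc : #|base U| = #|U| by apply: card_in_imset.
case Epk : [pick x in base U] => [x1|]; last first.
  by case: pickP Epk => // /(_ y0.1); rewrite yc.
have x1c : x1 \in base U by move: Epk; case: pickP => // ? ? [<-].
have : #|[set y.2 (base U) | y : Y in U]| <= #|base U :\ x1|.
  apply: subset_leq_card; apply/subsetP => _ /imsetP[y yU ->].
  have [h1 h2 _] := col _ nty y yU (yc y yU); rewrite !inE h1 andbT.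
  by apply: contraNneq h2 => ->; rewrite Epk.
rewrite card_in_imset; last first.
  move=> y y' yU yU' E; have [_ _ h] := col _ nty y yU (yc y yU).
  by apply: h => //; apply: yc.
by rewrite -Uc [X in X <= _](cardsD1 x1) x1c add1n ltnn.
Qed.

Definition key (y : Y) : K := y.1.1.

Lemma keysE (U : {set Y}) : keys (base U) = [set key y | y in U].
Proof.
apply/setP => kap; apply/imsetP/imsetP.
  by case=> _ /imsetP[y yU ->] ->; exists y.
by case=> y yU ->; exists y.1; rewrite ?imset_f.
Qed.

Lemma key_inj (U : {set Y}) (N : fin_structure sg) (t : K -> option N) : hyper U ->
  typedby (base U) t -> {in U &, injective key}.
Proof.
move=> [h1 _ _] [h2 _ _] y y' yU yU' E; apply: h1 => //; apply: h2 => //.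
  exact: imset_f.
exact: imset_f.
Qed.

Definition cover_vertex : finType := {y : Y | `[< hyper [set y] >]}.
Definition wkey (w : cover_vertex) := key (val w).

(** One hyperedge and one realisation suffice as witnesses, since [atom_holds_local] shows that the
    choice does not matter. *)
Definition cover_interp (R : symbol sg) (t : (arity R).-tuple cover_vertex) : Prop :=
  exists (U : {set Y}) (N : fin_structure sg) (tt : K -> option N)
    (vs : (arity R).-tuple nat) (e : nat -> option cover_vertex),
  [/\ hyper U, typedby (base U) tt, forall w, w \in t -> val w \in U, List.In (Rel vs) AA
    & map e vs = map Some t /\ atom_holds (pcomp (fun w => tt (wkey w)) e) (Rel vs)].

Definition cover : fin_structure sg :=
  @FinStructure sg cover_vertex (fun R t => `[< cover_interp t >]).

Notation W := cover.

Lemma cover_hom : is_hom (fun w : W => (wkey w).1).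
Proof.
move=> R t /asboolP[U [N [tt [vs [e [_ [_ [h [hh _ h3 _ _]] _] _ _ [Ee [s [Es Is]]]]]]]]].
have := hh R s Is; congr (is_true (interp _)); apply: val_inj => /=.
apply: (inj_map (@Some_inj _)).
transitivity (map (omap h) (map Some s)); first by rewrite -!map_comp.
rewrite -Es (eq_map (g := obind (fun w => tt (wkey w)) \o e)) // map_comp Ee -!map_comp.
apply/eq_in_map => w wt /=.
have : obind (fun w => tt (wkey w)) (Some w) \in map Some s.
  rewrite -Es (eq_map (g := obind (fun w => tt (wkey w)) \o e)) // map_comp Ee.
  by rewrite map_f // map_f.
by case/mapP => x _ /= E; rewrite E /= (h3 _ _ E).
Qed.

Lemma typedby_def (U : {set Y}) (N : fin_structure sg) (t : K -> option N) y :
  typedby (base U) t -> y \in U -> exists c, t (key y) = Some c.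
Proof.
move=> [_ [h [_ h2 _ _ _]] _] yU; have : isSome (t (key y)).
  by rewrite -h2 keysE imset_f.
by case: (t (key y)) => // c; exists c.
Qed.

(** If the atom is witnessed in another hyperedge, its vertices lie in both and [transfer_atom]
    applies. For equalities, the realisation is injective on keys and keys determine the vertices of
    [U]. *)
Lemma atom_holds_local (U : {set Y}) (N : fin_structure sg) (t : K -> option N)
  a (e : assignment W) :
  hyper U -> typedby (base U) t -> List.In a AA ->
  (forall x (w : W), x \in atom_vars a -> e x = Some w -> val w \in U) ->
  atom_holds e a <-> atom_holds (pcomp (fun w => t (wkey w)) e) a.
Proof.
move=> hU tU; case: a => [R vs|x y] aA eU; last first.
  split=> /= -[c [E1 E2]].
    have [|d Ed] := typedby_def (y := val c) tU.
      by apply: eU E1; rewrite /= inE eqxx.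
    by exists d; rewrite /pcomp E1 E2.
  move: E1 E2; rewrite /pcomp; case Ex: (e x) => [w|] //=; case Ey: (e y) => [w'|] //= E1 E2.
  exists w; split=> //; congr Some; apply: val_inj; apply: (key_inj hU tU).
  - by apply: eU Ey; rewrite /= !inE eqxx orbT.
  - by apply: eU Ex; rewrite /= inE eqxx.
  by case: tU => _ [h [_ _ _ h4 _]] _; apply: h4 E2 E1.
split.
  case=> s [Es /asboolP[U2 [N2 [t2 [vs2 [e2 [hU2 tU2 sU2 aA2 [Ee2 [s2 [Es2 Is2]]]]]]]]]].
  have h2 : atom_holds (pcomp t2 (fun x => omap wkey (e x))) (Rel vs).
    exists s2; split=> //.
    rewrite (eq_map (g := obind (fun w => t2 (wkey w)) \o e)); last first.
      by move=> x /=; rewrite /pcomp; case: (e x).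
    by rewrite map_comp Es -Ee2 -map_comp -Es2; apply: eq_map.
  have := transfer_atom tU2 tU aA _ h2.
  move=> H; apply: (atom_holds_ext (e := pcomp t (fun x => omap wkey (e x)))).
    by move=> x _; rewrite /pcomp; case: (e x).
  apply: H => x kap xv; case Ex: (e x) => [w|] //= [<-].
  have wU := eU x w xv Ex.
  have ws : w \in s := map_Some_in Es xv Ex.
  have wU2 := sU2 _ ws.
  apply/imsetP; exists (val w).1 => //; rewrite inE.
  by apply/andP; split; apply: imset_f.
move=> ha; have [s [Es Is]] := ha.
have [|u Eu] := @all_some cover_vertex (arity R) (map e vs) (size_tuple _).
  apply/allP => _ /mapP[x xv ->]; have [c] := atom_holds_def ha xv.
  by rewrite /pcomp; case: (e x).
exists u; split=> //; apply/asboolP; exists U, N, t, vs, e; split=> //.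
move=> w wu; have : Some w \in map Some u by rewrite map_f.
by rewrite -Eu => /mapP[x xv /esym Ex]; apply: eU Ex.
Qed.

End Cover.

(** * Extending a hyperedge by new vertices *)

Section Extension.
Variables (sg : vocabulary) (g : guarding) (V : seq nat).
Variables (AA : seq (atom sg)) (MM : seq (seq nat * seq (atom sg))).
Variables (k : nat) (A0 B : fin_structure sg).
Notation K := (cover_key V B).
Notation X := (hashed_key g V AA MM k B).
Notation Y := (coloured_key g V AA MM k B).
Notation realises := (realises g AA MM k A0).
Notation typedby := (typedby A0).
Notation typed := (typed A0).
Notation hyper := (hyper A0).
Notation state := (state g AA MM k).

(* A new key takes, in the column of a set of keys for which it is the designated new
   one, the hash that makes the sum correct; its colours avoid those used in [S]. *)
Lemma hyper_extend (S : {set Y}) (I2 : {set K}) (N2 : fin_structure sg) (t2 : K -> option N2) :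
  hyper S -> realises I2 t2 -> keys (base S) \subset I2 ->
  (forall T' : {set X}, T' \subset base S -> T' != set0 ->
     hash T' = code (restr_state (keys T') (state t2))) ->
  exists U2 : {set Y}, [/\ S \subset U2, hyper U2, typedby (base U2) t2
    & keys (base U2) = I2].
Proof.
move=> hS rI sJ hashS.
have [injS [N [t [injT1 _ _]]] colS] := hS.
set T1 := base S in sJ hashS injT1; set J := keys T1 in sJ.
pose new := I2 :\: J.
pose des (I' : {set K}) := [pick kap in I' :\: J].
pose F kap : {ffun {set K} -> _} := [ffun I' : {set K} =>
  if des I' == Some kap then
    (code (restr_state I' (state t2)) - \sum_(x in T1 | x.1 \in I') x.2 I')%R else 0%R].
pose xk kap : X := (kap, F kap).
have xkI : injective xk by move=> a b [].
pose T2 := T1 :|: [set xk kap | kap in new].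
have JP (x : X) : x \in T1 -> x.1 \in J by move=> h; apply/imsetP; exists x.
have newP (x : X) : x \in [set xk kap | kap in new] ->
  [/\ x.1 \in I2, x.1 \notin J & x = xk x.1].
  by case/imsetP => kap; rewrite inE => /andP[h1 h2] ->.
have injT2 : {in T2 &, injective fst}.
  move=> x y; rewrite !inE => /orP[xT|/newP[_ x1 x2]] /orP[yT|/newP[_ y1 y2]] E.
  - exact: injT1.
  - by case/negP: y1; rewrite -E JP.
  - by case/negP: x1; rewrite E JP.
  - by rewrite x2 y2 E.
have keysT2 : keys T2 = I2.
  apply/setP => kap; apply/imsetP/idP.
    case=> x; rewrite inE => /orP[/JP h ->|/newP[h _ _] -> //].
    exact: (subsetP sJ).
  move=> kI; case: (boolP (kap \in J)) => kJ.
    by case/imsetP: kJ => x xT ->; exists x; rewrite // inE xT.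
  by exists (xk kap) => //; rewrite inE; apply/orP; right; apply: imset_f; rewrite inE kJ.
have tyT2 : typedby T2 t2.
  split=> //; first by rewrite keysT2.
  move=> T' sub ne.
  case: (boolP (keys T' \subset J)) => [sK|nK].
    apply: hashS => //; apply/subsetP => x xT'.
    have := subsetP sub _ xT'; rewrite inE => /orP[//|/newP[_ h _]].
    by case/negP: h; apply: (subsetP sK); apply/imsetP; exists x.
  have [kap0 Ed] : exists kap0, des (keys T') = Some kap0.
    rewrite /des; case: pickP => [kap0 _|h]; first by exists kap0.
    case/negP: nK; apply/subsetP => kap kT; have := h kap.
    by rewrite !inE kT andbT => /negbT; rewrite negbK.
  have [k0T k0J] : kap0 \in keys T' /\ kap0 \notin J.
    by move: Ed; rewrite /des; case: pickP => // kap1; rewrite inE => /andP[h1 h2] [<-].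
  have [x0 x0T Ex0] := imsetP k0T.
  have new_x (x : X) : x \in T' -> x \notin T1 -> x = xk x.1.
    by move=> /(subsetP sub); rewrite inE => /orP[->//|/newP[_ _ E] _].
  have x0T1 : x0 \notin T1 by apply: contra k0J => /JP; rewrite -Ex0.
  rewrite /hash (bigID (fun x => x \in T1)) /=.
  (* [F] sees only the keys of [T']. As keys are injective on [T2], these determine the old part of
     [T']. *)
  have E1 : (\sum_(x in T' | x \in T1) x.2 (keys T') =
     \sum_(x in T1 | x.1 \in keys T') x.2 (keys T'))%R.
    apply: eq_bigl => x; apply/andP/andP => -[h1 h2]; split=> //.
      by apply/imsetP; exists x.
    case/imsetP: h2 => x' x'T E; rewrite (injT2 x x') ?E //.
      by rewrite inE h1.
    exact: (subsetP sub).
  rewrite E1; set S1 := (X in (X + _)%R); rewrite (bigD1 x0) /=; last by rewrite x0T.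
  rewrite big1 ?GRing.addr0; last first.
    move=> x /andP[/andP[xT xT1] ne0]; rewrite (new_x x) //= ffunE Ed.
    case: eqP => // -[E]; case/eqP: ne0; rewrite (new_x x) // (new_x x0) //.
    by rewrite -Ex0 -E.
  by rewrite (new_x x0) //= ffunE Ed -Ex0 eqxx GRing.addrC GRing.subrK.
have ty2 : typed T2 by exists N2, t2.
have [f Pf] : {f : {set X} -> X -> X & forall c : {set X}, ~ typed c ->
    forall kap, kap \in new -> xk kap \in c ->
    [/\ f c (xk kap) \in c, Some (f c (xk kap)) != [pick x in c],
     forall y, y \in S -> y.1 \in c -> y.2 c <> f c (xk kap) &
     forall kap', kap' \in new -> xk kap' \in c -> f c (xk kap) = f c (xk kap') -> kap = kap']}.
  apply: (@choice _ _ (fun (c : {set X}) (fc : X -> X) => ~ typed c ->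
    forall kap, kap \in new -> xk kap \in c ->
    [/\ fc (xk kap) \in c, Some (fc (xk kap)) != [pick x in c],
     forall y, y \in S -> y.1 \in c -> y.2 c <> fc (xk kap) &
     forall kap', kap' \in new -> xk kap' \in c -> fc (xk kap) = fc (xk kap') -> kap = kap'])).
  move=> c; case: (pselect (typed c)) => [tc|nc]; first by exists id.
  case Epk : [pick x in c] => [x1|]; last first.
    exists id => _ kap _ xc; move: Epk; case: pickP => // /(_ (xk kap)).
    by rewrite /= xc.
  have x1c : x1 \in c by move: Epk; case: pickP => // ? ? [<-].
  pose Nc := c :&: [set xk kap | kap in new].
  pose used := [set y.2 c | y : Y in [set y in S | y.1 \in c]].
  pose C := enum (c :\ x1 :\: used).
  have szC : #|Nc| <= size C.
    rewrite -cardE.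
    (* Since [T2] is typed, the untyped [c] is not contained in it. Hence [c] meets [T2] in fewer
       than [#|c|] elements, and after deducting the colours used on [S] one colour remains for each
       new element of [c]. *)
    have h1 : #|c :&: T2| <= #|c|.-1.
      have : #|c :&: T2| < #|c|.
        apply: proper_card; rewrite properEneq subsetIl andbT.
        apply/eqP => /setIidPl sub; apply: nc; exact: typed_sub sub ty2.
      by case: #|c|.
    have h2 : #|c :&: T2| = #|c :&: T1| + #|Nc|.
      rewrite /T2 setIUr cardsU.
      suff -> : c :&: T1 :&: (c :&: [set xk kap | kap in new]) = set0.
        by rewrite cards0 subn0.
      apply/setP => x; rewrite !inE; apply/negP => /andP[/andP[_ h] /andP[_ /newP[_ h' _]]].
      by case/negP: h'; apply: JP.
    have h3 : #|used| <= #|c :&: T1|.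
      apply: leq_trans (leq_imset_card _ _) _.
      rewrite -(card_in_imset (f := fst) (D := mem [set y in S | y.1 \in c])) => [|y y'].
        apply: subset_leq_card; apply/subsetP => x /imsetP[y]; rewrite inE => /andP[h h'] ->.
        by rewrite inE h' imset_f.
      by rewrite !inE => /andP[h _] /andP[h' _]; apply: injS.
    have h4 : #|c :\ x1| = #|c|.-1 by rewrite (cardsD1 x1 c) x1c.
    rewrite cardsD h4.
    apply: leq_trans (_ : #|c|.-1 - #|used| <= _); last first.
      by apply: leq_sub2l; apply: subset_leq_card; apply: subsetIr.
    by rewrite leq_subRL ?(leq_trans h3) // ?(leq_trans _ h1) // h2 ?leq_addr // leq_add2r.
  have [nu [nuC nuI]] := fresh x1 (enum_uniq _) szC.
  exists nu => _ kap kn kc.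
  have xN : xk kap \in Nc by rewrite inE kc imset_f.
  have := nuC _ xN; rewrite mem_enum !inE => /and3P[n1 n2 n3]; split=> //.
  - move=> y yS yc E; case/negP: n1; apply/imsetP; exists y; rewrite ?E //.
    by rewrite inE yS.
  - move=> kap' kn' kc' /nuI E; apply: xkI; apply: E => //.
    by rewrite inE kc' imset_f.
pose yk kap : Y := (xk kap, [ffun c => f c (xk kap)]).
pose U2 := S :|: [set yk kap | kap in new].
have baseU2 : base U2 = T2.
  rewrite /base /U2 imsetU; congr (_ :|: _).
  by rewrite -imset_comp.
exists U2; rewrite baseU2; split=> //; first exact: subsetUl.
have ynewP (y : Y) : y \in [set yk kap | kap in new] ->
  exists2 kap, kap \in new & y = yk kap by move/imsetP.
split; last 1 first.
- move=> c nc y; rewrite inE => /orP[yS|/ynewP[kap kn ->]] yc.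
    have [h1 h2 h3] := colS c nc y yS yc; split=> // y'.
    rewrite inE => /orP[yS'|/ynewP[kap' kn' ->]]; first exact: h3.
    move=> yc'; rewrite ffunE => E.
    by have [_ _ /(_ y yS yc)] := Pf c nc kap' kn' yc'.
  have [h1 h2 h3 h4] := Pf c nc kap kn yc; rewrite ffunE; split=> // y'.
  rewrite inE => /orP[yS'|/ynewP[kap' kn' ->]] yc' E.
    by case: (h3 y').
  by rewrite ffunE in E; rewrite (h4 kap').
- move=> y y'; rewrite !inE => /orP[yS|/ynewP[kap kn ->]] /orP[yS'|/ynewP[kap' kn' ->]] /=.
  + exact: injS.
  + move=> E; case/newP: (imset_f xk kn') => _ /negP[]; rewrite -E.
    by apply: JP; apply: imset_f.
  + move=> E; case/newP: (imset_f xk kn) => _ /negP[]; rewrite E.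
    by apply: JP; apply: imset_f.
  + by move=> /xkI ->.
- by rewrite baseU2.
Qed.

End Extension.

(** * The back-and-forth game between covers *)

Section Forth.
Variables (sg : vocabulary) (g : guarding) (V : seq nat).
Variables (AA : seq (atom sg)) (MM : seq (seq nat * seq (atom sg))).
Hypothesis AA_V : forall a, List.In a AA -> {subset atom_vars a <= V}.
Hypothesis MM_guard : forall xs G, List.In (xs, G) MM -> is_guard g xs G [::].
Hypothesis MM_AA : forall xs G a, List.In (xs, G) MM -> List.In a G -> List.In a AA.
Variables (k : nat) (A0 : fin_structure sg).
Notation sim := (sim g V AA MM).
Notation move := (move g V MM).
Notation K := (cover_key V).
Notation X := (hashed_key g V AA MM k).
Notation Y := (coloured_key g V AA MM k).
Notation realises := (realises g AA MM k A0).
Notation typedby := (typedby A0).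
Notation typed := (typed A0).
Notation hyper := (hyper A0).
Notation state := (state g AA MM k).
Notation W := (cover g V AA MM k A0).

(** Candidates are existential positive, so [h] preserves them and [h'] brings them back. *)
Lemma theory_at_retract (N N' : fin_structure sg) (h : N -> N') (h' : N' -> N) (e : assignment N) :
  is_hom h -> is_hom h' -> cancel h h' ->
  theory_at g V AA MM k (pcomp (fun x => Some (h x)) e : assignment N') = theory_at g V AA MM k e.
Proof.
move=> hh hh' hK; apply/setP => i; rewrite !inE.
have /cand_good/and4P[_ ep _ _] := @nth_candidates _ g V AA MM k i.
apply/asboolP/asboolP => [H|]; last exact: ep_hom.
have -> : e = pcomp (fun x => Some (h' x)) (pcomp (fun x => Some (h x)) e).
  by apply: funext => x; rewrite /pcomp; case: (e x) => //= c; rewrite hK.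
exact: ep_hom.
Qed.

Lemma cover_rel (B : fin_structure sg) R (t : (arity R).-tuple (W B)) : interp t ->
  exists2 U : {set Y B}, hyper U & forall w, w \in t -> val w \in U.
Proof.
by move=> /asboolP[U [N [tt [vs [e [hU _ h _ _]]]]]]; exists U.
Qed.

Lemma atom_hyper (B : fin_structure sg) (d : assignment (W B)) a x x' w w' :
  atom_holds d a -> x \in atom_vars a -> x' \in atom_vars a ->
  d x = Some w -> d x' = Some w' ->
  exists U : {set Y B}, [/\ hyper U, val w \in U & val w' \in U].
Proof.
case: a => [R vs|y y'] da xa xa' Ex Ex'.
  case: da => t [Et /cover_rel[U hU sU]]; exists U; split=> //; apply: sU.
    exact: map_Some_in Et xa Ex.
  exact: map_Some_in Et xa' Ex'.
rewrite -(Eq_vals da xa xa' Ex Ex').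
exists [set val w]; split; rewrite ?inE //; exact/asboolP/(valP w).
Qed.

Section Two.
Variables B1 B2 : fin_structure sg.

(** The invariant of the game, with [F] the variables in play. The comparison takes place between
    the realisations [N1] and [N2], and [p] and [pi] need to invert each other only on the values of
    these variables. *)
Definition position m (F : pred nat) (e1 : assignment (W B1)) (e2 : assignment (W B2)) :=
  exists (U1 : {set Y B1}) (U2 : {set Y B2}) (N1 N2 : fin_structure sg)
    (t1 : K B1 -> option N1) (t2 : K B2 -> option N2)
    (p : N1 -> option N2) (pi : N2 -> option N1),
  [/\ hyper U1 /\ hyper U2, typedby (base U1) t1 /\ typedby (base U2) t2,
      sim m p /\ sim m pi &
      forall x, F x -> exists w1 w2 n1 n2,
        [/\ e1 x = Some w1, e2 x = Some w2, val w1 \in U1 /\ val w2 \in U2,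
            t1 (wkey w1) = Some n1 /\ t2 (wkey w2) = Some n2
          & p n1 = Some n2 /\ pi n2 = Some n1]].

(* The move is played in the structure [N] realising the values of [d1].  [N] simulates
   [N2] on the retained values, and unravelling it onto [N2] yields a structure [QQ]
   realising, over [B2], the old vertices of [U2] together with the new ones. *)
Lemma forth m (F : pred nat) e1 e2 xs G (d1 : assignment (W B1)) (zs : seq nat) :
  typed (set0 : {set X B1}) ->
  m < k -> position m.+1 F e1 e2 -> List.In (xs, G) MM ->
  reassigns xs e1 d1 -> conj_holds d1 G ->
  {subset zs <= V} -> all (live g xs G) zs ->
  (forall x, x \in conj_vars G ++ zs -> x \notin xs -> F x) ->
  exists d2 : assignment (W B2), [/\ reassigns xs e2 d2, conj_holds d2 G
    & position m (mem zs) d1 d2].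
Proof.
move=> ty0 ltm [U1 [U2 [N1 [N2 [t1 [t2 [p [pi [[hU1 hU2] [tU1 tU2] [sp spi] PF]]]]]]]]]
  inM [d1o d1i] d1G zsV zsL retF.
have gG := MM_guard inM.
pose Lv := xs ++ conj_vars G ++ zs.
have GV x : x \in conj_vars G -> x \in V.
  by case/mem_conj_vars => a aG; apply: AA_V; apply: MM_AA inM aG.
have LvV x : x \in Lv -> x \in V.
  rewrite !mem_cat => /or3P[/(guard_xs gG)|//|]; first exact: GV.
    exact: GV.
  exact: zsV.
have LvL x : x \in Lv -> live g xs G x.
  rewrite !mem_cat => /or3P[/(guard_xs gG)/(live_guard gG)//|/(live_guard gG)//|h].
  by move/allP: zsL; apply.
have LvF x : x \in Lv -> x \notin xs -> F x.
  by move=> h xx; apply: retF => //; move: h; rewrite /Lv mem_cat (negPf xx).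
have LvD x : x \in Lv -> exists w, d1 x = Some w.
  move=> h; case: (boolP (x \in xs)) => xx; first by apply: d1i.
  have [w1 [w2 [n1 [n2 [E _ _ _ _]]]]] := PF x (LvF x h xx).
  by exists w1; rewrite d1o.
pose U1' : {set Y B1} := [set y | has (fun x => omap val (d1 x) == Some y) Lv].
have U1'P x w : x \in Lv -> d1 x = Some w -> val w \in U1'.
  by move=> h E; rewrite inE; apply/hasP; exists x; rewrite // E.
(* A pair involving a rebound variable occurs in an atom of the guard, hence in a hyperedge; two
   retained values lie together in [U1]. *)
have hU1' : hyper U1'.
  have pair x x' w w' : x \in xs -> x' \in Lv -> d1 x = Some w -> d1 x' = Some w' ->
    exists U : {set Y B1}, [/\ hyper U, val w \in U & val w' \in U].
    move=> xx x'L E E'; have [a [aG xa xa']] := live_pair gG xx (LvL _ x'L).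
    by apply: atom_hyper xa xa' E E'; move/conj_holdsP: d1G; apply.
  apply: hyper_pairs => // y y'; rewrite !inE => /hasP[x xL Ey] /hasP[x' x'L Ey'].
  have [w E] := LvD x xL; have [w' E'] := LvD x' x'L.
  move: Ey Ey'; rewrite E E' => /eqP[<-] /eqP[<-].
  case: (boolP (x \in xs)) => xx; first exact: pair xx x'L E E'.
  case: (boolP (x' \in xs)) => xx'.
    by have [U [h1 h2 h3]] := pair _ _ _ _ xx' xL E' E; exists U.
  have [v1 [v2 [n1 [n2 [F1 _ [F2 _] _ _]]]]] := PF x (LvF x xL xx).
  have [v1' [v2' [n1' [n2' [F1' _ [F2' _] _ _]]]]] := PF x' (LvF x' x'L xx').
  exists U1; split=> //.
    by move: E; rewrite d1o // F1 => -[<-].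
  by move: E'; rewrite d1o // F1' => -[<-].
have [_ [N [t tU1']] _] := hU1'.
pose S1 : {set Y B1} := [set y | has (fun x => (x \notin xs) && (omap val (d1 x) == Some y)) Lv].
have S1P x w : x \in Lv -> x \notin xs -> d1 x = Some w -> val w \in S1.
  by move=> h xx E; rewrite inE; apply/hasP; exists x; rewrite // E xx /=.
have S1U1' : S1 \subset U1'.
  apply/subsetP => y; rewrite !inE => /hasP[x h /andP[_ E]].
  by apply/hasP; exists x.
have S1U1 : S1 \subset U1.
  apply/subsetP => y; rewrite !inE => /hasP[x h /andP[xx]].
  have [w1 [w2 [n1 [n2 [E _ [w1U _] _ _]]]]] := PF x (LvF x h xx).
  by rewrite d1o // E => /eqP[<-].
have szS1 : #|base S1| <= num_vars_V V.
  apply: leq_trans (leq_imset_card _ _) _.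
  apply: leq_trans (_ : #|pmap (fun x => omap val (d1 x)) (undup V)| <= _).
    apply: subset_leq_card; apply/subsetP => y; rewrite inE => /hasP[x h /andP[_ /eqP E]].
    by rewrite mem_pmap -E (map_f (fun x => omap val (d1 x))) // mem_undup LvV.
  by apply: leq_trans (card_size _) _; rewrite size_pmap count_size.
(* [q] and [qi] pass between the new realisation [N] and the old one [N1] along the retained keys,
   whose theories agree in both. *)
pose q n := if [pick kap in keys (base S1) | t kap == Some n] is Some kap then t1 kap else None.
pose qi n1 := if [pick kap in keys (base S1) | t1 kap == Some n1] is Some kap then t kap else None.
have bS1 : base S1 \subset base U1 by apply: imsetS.
have bS1' : base S1 \subset base U1' by apply: imsetS.
have sq : sim k q.
  apply: (agree_sim AA_V MM_guard MM_AA tU1' tU1 bS1' bS1 szS1) => x y.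
  by rewrite /q; case: pickP => // kap /andP[h1 /eqP h2] h3; exists kap.
have sqi : sim k qi.
  apply: (agree_sim AA_V MM_guard MM_AA tU1 tU1' bS1 bS1' szS1) => x y.
  by rewrite /qi; case: pickP => // kap /andP[h1 /eqP h2] h3; exists kap.
pose r0 n := obind p (q n).
pose ri0 n := obind qi (pi n).
have sr0 : sim m.+1 r0 by apply: sim_comp => //; apply: sim_leq sq.
have sri0 : sim m.+1 ri0 by apply: sim_comp => //; apply: sim_leq sqi.
(* Restricted to where the two composites are mutually inverse, since the unravelling glues along a
   partial injection. *)
pose r n := if r0 n is Some n2 then if ri0 n2 == Some n then Some n2 else None else None.
pose ri n2 := if ri0 n2 is Some n then if r0 n == Some n2 then Some n else None else None.
have sr : sim m.+1 r.
  by apply: sim_sub sr0 => x y; rewrite /r; case: (r0 x) => // ?; case: ifP.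
have sri : sim m.+1 ri.
  by apply: sim_sub sri0 => x y; rewrite /ri; case: (ri0 x) => // ?; case: ifP.
have rK a y : r a = Some y -> ri y = Some a.
  rewrite /r /ri; case E: (r0 a) => [n2|] //; case: eqP => // E2 [<-].
  by rewrite E2 E eqxx.
have [_ [h1 [_ h1k _ h1i _]] _] := tU1.
have [_ [h0 [_ h0k _ h0i _]] _] := tU1'.
have [_ [h2 [hh2 h2k h2e h2i [h2s h2s']]] hash2] := tU2.
have ret x : x \in Lv -> x \notin xs -> exists w1 w2 n n2,
  [/\ d1 x = Some w1, e2 x = Some w2, val w2 \in U2,
      t (wkey w1) = Some n /\ t2 (wkey w2) = Some n2 & r n = Some n2].
  move=> xL xx; have [w1 [w2 [n1 [n2 [E1 E2 [u1 u2] [T1 T2] [P1 P2]]]]]] := PF x (LvF x xL xx).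
  have E1' : d1 x = Some w1 by rewrite d1o.
  have [n En] := typedby_def tU1' (U1'P x w1 xL E1').
  exists w1, w2, n, n2; split=> //.
  have kS : wkey w1 \in keys (base S1).
    by rewrite keysE /wkey imset_f // (S1P x).
  have Eq : q n = Some n1.
    rewrite /q; case: pickP => [kap /andP[_ /eqP E]|/(_ (wkey w1))].
      by rewrite (h0i _ _ _ E En).
    by rewrite kS En eqxx.
  have Eqi : qi n1 = Some n.
    rewrite /qi; case: pickP => [kap /andP[_ /eqP E]|/(_ (wkey w1))].
      by rewrite (h1i _ _ _ E T1).
    by rewrite kS T1 eqxx.
  by rewrite /r /r0 Eq /= P1 /ri0 P2 /= Eqi eqxx.
pose d' : assignment N := fun x => if x \in Lv then obind (fun w => t (wkey w)) (d1 x) else None.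
have d'P x n : d' x = Some n -> x \in Lv by rewrite /d'; case: ifP.
have d'L x w : x \in Lv -> d1 x = Some w -> exists2 n, t (wkey w) = Some n & d' x = Some n.
  move=> xL E; have [n En] := typedby_def tU1' (U1'P x w xL E).
  by exists n; rewrite // /d' xL E.
have md' : move xs G d'.
  split=> //; first by move=> x c /d'P h; split; [apply: LvV|apply: LvL].
  apply/conj_holdsP => a aG.
  have xaL x : x \in atom_vars a -> x \in Lv.
    by move=> xa; rewrite /Lv !mem_cat; apply/or3P/Or32; apply/mem_conj_vars; exists a.
  apply: (atom_holds_ext (e := pcomp (fun w => t (wkey w)) d1)).
    by move=> x xa; rewrite /d' xaL.
  apply/(atom_holds_local AA_V MM_AA hU1' tU1'); first exact: MM_AA inM aG.
    by move=> x w xa E; apply: U1'P E; apply: xaL.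
  by move/conj_holdsP: d1G; apply.
have intor : into r d' (fun x => x \notin xs).
  move=> x n xx E; have xL := d'P _ _ E.
  have [w1 [w2 [n' [n2 [F1 F2 _ [F3 _] F4]]]]] := ret x xL xx.
  by exists n2; move: E; rewrite /d' xL F1 /= F3 => -[<-].
have [p2 [p2i p2r p2s]] := sr.2 xs G d' md' intor.
pose S : {set N} := [set n | has (fun x => (x \notin xs) && (d' x == Some n)) Lv].
have SP x n : x \notin xs -> d' x = Some n -> n \in S.
  by move=> xx E; rewrite inE; apply/hasP; exists x; [apply: d'P E|rewrite xx E eqxx].
have SP' n : n \in S -> exists x, [/\ x \in Lv, x \notin xs & d' x = Some n].
  by rewrite inE => /hasP[x xL /andP[xx /eqP E]]; exists x.
(* The child of the root for this move: retained elements stay glued to [N2] through [r], and the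
   other ones are new copies over their images under [p2]. *)
pose w : seq (entry N N2) := [:: (S, finfun p2)].
have vw : valid g V AA MM r m.+1 w.
  split=> //=.
    move=> n /SP'[x [xL xx E]]; have [y Ey] := intor x n xx E.
    by exists y; rewrite // ffunE (p2r x).
  by rewrite subn1 /=; apply: sim_sub p2s => x y; rewrite ffunE.
have kF : ~~ true -> forall a, r a = None by [].
pose QQ := unravelling g V AA MM r m.+1 true.
pose elw : N -> option QQ := node_elt g V AA MM r m.+1 true w.
pose zw : QQ -> option N := node_inv ri w.
have selw : sim m elw by apply: (sim_node_elt sr rK kF) => //=; rewrite addn1.
have szw : sim m zw by apply: (sim_node_inv MM_guard MM_AA sr rK (fun _ => sri) kF) => //.
pose rh : QQ -> N2 := fun z => proj z.
have hrho : is_hom rh := hom_proj sr rK kF.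
pose io : N2 -> QQ := fun y => root_emb g V AA MM r m.+1 (erefl true : is_true true) y.
have hio : is_hom io := hom_root_emb g V AA MM r m.+1 (erefl true : is_true true).
have elwP n y : p2 n = Some y -> exists qq : QQ, [/\ elw n = Some qq, rh qq = y & zw qq = Some n].
  move=> E; have [|qq E1 [E2 E3]] := @node_elt_map _ g V AA MM _ _ r ri m.+1 true rK kF w n y vw.
    by rewrite /= ffunE.
  exists qq; split=> //; rewrite /zw /node_inv.
  by rewrite (_ : in_node w qq) //; apply/existsP; exists n; apply/eqP.
have elwS n y : n \in S -> r n = Some y -> elw n = Some (io y).
  by move=> nS E; apply: raw_node_elt; rewrite /= nS E.
pose T : {set N} := [set n | has (fun x => d' x == Some n) Lv].
have TP n : n \in T -> exists2 x, x \in Lv & d' x = Some n.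
  by rewrite inE => /hasP[x xL /eqP E]; exists x.
pose S2 : {set Y B2} := [set y | has (fun x => (x \notin xs) && (omap val (e2 x) == Some y)) Lv].
have S2U2 : S2 \subset U2.
  apply/subsetP => y; rewrite inE => /hasP[x xL /andP[xx]].
  have [w1 [w2 [n [n2 [_ E u2 _ _]]]]] := ret x xL xx.
  by rewrite E => /eqP[<-].
have bS2 : base S2 \subset base U2 by apply: imsetS.
pose J := keys (base S2).
have szT : #|T :\: S| <= num_vars_V V.
  apply: leq_trans (subset_leq_card (subsetDl _ _)) _.
  apply: leq_trans (_ : #|pmap d' (undup V)| <= _).
    apply: subset_leq_card; apply/subsetP => n /TP[x xL E].
    by rewrite mem_pmap -E map_f // mem_undup LvV.
  by apply: leq_trans (card_size _) _; rewrite size_pmap count_size.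
have szJ : #|[set kap.2 | kap in J]| <= num_vars_V V.
  apply: leq_trans (leq_imset_card _ _) _.
  apply: leq_trans (leq_imset_card _ _) _.
  apply: leq_trans (leq_imset_card _ _) _.
  apply: leq_trans (_ : #|pmap (fun x => omap val (e2 x)) (undup V)| <= _).
    apply: subset_leq_card; apply/subsetP => y; rewrite inE => /hasP[x h /andP[_ /eqP E]].
    by rewrite mem_pmap -E (map_f (fun x => omap val (e2 x))) // mem_undup LvV.
  by apply: leq_trans (card_size _) _; rewrite size_pmap count_size.
have [id [idC idI]] : exists id : N -> key_index V,
    (forall n, n \in T :\: S -> id n \in enum (~: [set kap.2 | kap in J])) /\
    {in T :\: S &, injective id}.
  apply: (fresh (ord0 : key_index V)); first exact: enum_uniq.
  rewrite -cardE [X in _ <= X]cardsCs setCK card_ord; apply: leq_trans szT _.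
  rewrite leq_subRL; first by apply: leqW; rewrite leq_add2r.
  by apply: leq_trans szJ _; rewrite -addnS leq_addr.
(* The key of a new element is the element of [B2] below it together with an index that no retained
   key carries. *)
pose krel n (kap : K B2) := [&& n \in T :\: S, omap h2 (p2 n) == Some kap.1 & id n == kap.2].
have krelJ n kap : krel n kap -> kap \notin J.
  case/and3P => nT _ /eqP E; apply/negP => kJ.
  have := idC n nT; rewrite mem_enum inE E => /negP[]; exact: imset_f.
pose tq (kap : K B2) : option QQ := if kap \in J then omap io (t2 kap)
  else if [pick n | krel n kap] is Some n then elw n else None.
pose I2 : {set K B2} := J :|: [set kap | [exists n, krel n kap]].
have p2T n : n \in T -> exists y, p2 n = Some y.
  by move=> /TP[x xL E]; apply: p2i E.
have krel_inj n n' kap : krel n kap -> krel n' kap -> n = n'.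
  by move=> /and3P[h _ /eqP E] /and3P[h' _ /eqP E']; apply: idI; rewrite // E E'.
have tq_krel n kap : krel n kap -> tq kap = elw n.
  move=> h; rewrite /tq (negPf (krelJ _ _ h)); case: pickP => [n' h'|/(_ n)].
    by rewrite (krel_inj _ _ _ h h').
  by rewrite h.
have elwN n y qq : n \notin S -> elw n = Some qq -> qq <> io y.
  move=> nS /node_elt_raw /=; rewrite (negPf nS); case: (finfun p2 n) => // y' [E] E2.
  by rewrite E2 in E.
have tqI kap : kap \in I2 -> exists qq, tq kap = Some qq.
  rewrite inE => /orP[kJ|]; last first.
    rewrite inE => /existsP[n h]; rewrite (tq_krel n) //.
    have /and3P[+ _ _] := h; rewrite inE => /andP[_ /p2T[y /elwP[qq [-> _ _]]]].
    by exists qq.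
  have : isSome (t2 kap) by rewrite -h2k; apply: (subsetP (keysS bS2)).
  by rewrite /tq kJ; case: (t2 kap) => // c _; exists (io c).
have tqI' kap qq : tq kap = Some qq -> kap \in I2.
  rewrite /tq /I2 !inE; case: ifP => //= _; case: pickP => // n h _.
  by apply/existsP; exists n.
have tq_cases kap qq : tq kap = Some qq ->
  (kap \in J /\ exists2 c, t2 kap = Some c & qq = io c) \/
  (exists2 n, krel n kap & elw n = Some qq).
  rewrite /tq; case: ifP => kJ.
    by case E: (t2 kap) => [c|] //= [<-]; left; split=> //; exists c.
  by case: pickP => // n h E; right; exists n.
have rz : realises I2 tq.
  exists (h2 \o rh); split.
  - by move=> R u /hrho /hh2; congr (is_true (interp _)); apply: val_inj; rewrite /= -map_comp.
  - move=> kap; apply/idP/idP => [/tqI[qq ->]//|].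
    by case E: (tq kap) => [qq|] // _; apply: tqI' E.
  - move=> kap qq /tq_cases[[kJ [c E ->]]|[n kr E]] /=; first exact: h2e.
    have /and3P[nT /eqP E2 _] := kr; rewrite inE in nT; case/andP: nT => _ /p2T[y Ey].
    have [qq' [E3 E4 _]] := elwP n y Ey; rewrite E in E3; case: E3 => E3; rewrite -E3 in E4.
    by rewrite E4; move: E2; rewrite Ey => -[].
  - move=> kap kap' qq /tq_cases[[kJ [c E Eq]]|[n kr E]] /tq_cases[[kJ' [c' E' Eq']]|[n' kr' E']].
    + have Ec : c = c' by have : rh (io c) = rh (io c') by rewrite -Eq -Eq'.
      by rewrite -Ec in E'; apply: h2i E E'.
    + by have /and3P[+ _ _] := kr'; rewrite inE => /andP[nS _]; case: (elwN n' c qq nS E').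
    + by have /and3P[+ _ _] := kr; rewrite inE => /andP[nS _]; case: (elwN n c' qq nS E).
    have /and3P[nT Z2 Z3] := kr; have /and3P[nT' Z2' Z3'] := kr'.
    have : n = n'.
      have /setDP[/p2T[y Ey] _] := nT; have /setDP[/p2T[y' Ey'] _] := nT'.
      have [q1 [F1 _ F2]] := elwP _ _ Ey; have [q2 [F1' _ F2']] := elwP _ _ Ey'.
      move: F1 F1'; rewrite E E' => -[Z] [Z']; rewrite -Z in F2; rewrite -Z' in F2'.
      by move: F2; rewrite F2' => -[].
    move=> En; rewrite -En in Z2' Z3'; move: Z2 Z3; rewrite (eqP Z2') (eqP Z3').
    by case: (kap) => a b; case: (kap') => a' b' /= /eqP[->] /eqP->.
  - have ee (M M' : fin_structure sg) (u : M -> M') : is_hom u -> empty_sim g V AA MM k M M'.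
      by move=> hu; apply: sim_sub (sim_hom g V AA MM k hu).
    by split; [apply: (empty_sim_trans MM_AA h2s (ee _ _ _ hio))
              |apply: (empty_sim_trans MM_AA (ee _ _ _ hrho) h2s')].
(* Gluing a tree to [N2] does not change the theories of the retained keys, because [N2] is a
   retract of [QQ]. *)
have hashS2 (T' : {set X B2}) : T' \subset base S2 -> T' != set0 ->
  hash T' = code (restr_state (keys T') (state tq)).
  move=> sub ne; rewrite hash2 //; last exact: subset_trans bS2.
  congr code; rewrite !restr_stateE; apply/ffunP => e; rewrite !ffunE.
  rewrite -(theory_at_retract (h := io) (h' := rh)) //; congr theory_at; apply: funext => x.
  rewrite /pcomp; case: (assign_of e x) => //= kap; rewrite /restr; case: ifP => // kT.
  rewrite /tq (subsetP (keysS sub)) //; by case: (t2 kap).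
have [U2' [S2U hU2' tU2' kU2']] := hyper_extend
  (hyper_sub S2U2 hU2) rz (subsetUl _ _) hashS2.
have vert n : n \in T -> exists w2 : W B2, val w2 \in U2' /\ tq (wkey w2) = elw n.
  move=> nT.
  have [y yU Ey] : exists2 y, y \in U2' & tq (key y) = elw n.
    case: (boolP (n \in S)) => nS.
      have [x [xL xx E]] := SP' n nS.
      have [w1 [w2 [n' [n2 [F1 F2 _ [F3 F4] F5]]]]] := ret x xL xx.
      have En : n' = n by move: E; rewrite /d' xL F1 /= F3 => -[].
      have yS : val w2 \in S2.
        by rewrite inE; apply/hasP; exists x; rewrite // xx F2 /=.
      exists (val w2); first exact: (subsetP S2U).
      have kJ : key (val w2) \in J by rewrite /J keysE imset_f.
      rewrite /tq kJ (elwS _ n2) // -?En // -/(wkey w2).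
      by rewrite [t2 _]F4.
    have [y Ey] := p2T n nT.
    have kr : krel n (h2 y, id n) by rewrite /krel inE nS nT Ey /= !eqxx.
    have : (h2 y, id n) \in keys (base U2').
      by rewrite kU2' inE; apply/orP; right; rewrite inE; apply/existsP; exists n.
    rewrite keysE => /imsetP[y2 y2U E]; exists y2 => //.
    by rewrite -E (tq_krel n).
  have hy : `[< hyper [set y] >].
    by apply/asboolP; apply: hyper_sub hU2'; rewrite sub1set.
  by exists (Sub y hy).
pose d2 : assignment (W B2) := fun x => if x \in xs then
  [pick w2 : W B2 | (val w2 \in U2') && (tq (wkey w2) == obind elw (d' x))] else e2 x.
have main x : x \in Lv -> exists w1 w2 n qq,
  [/\ d1 x = Some w1, d2 x = Some w2, val w1 \in U1' /\ val w2 \in U2',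
      t (wkey w1) = Some n /\ tq (wkey w2) = Some qq
    & [/\ elw n = Some qq, zw qq = Some n & d' x = Some n]].
  move=> xL; have [w1 E1] := LvD x xL; have [n En Ed] := d'L x w1 xL E1.
  have nT : n \in T by rewrite inE; apply/hasP; exists x; rewrite // Ed.
  have [y Ey] := p2T n nT; have [qq [F1 F2 F3]] := elwP n y Ey.
  have [w2 [E2 [w2U Ew2]]] : exists w2, d2 x = Some w2 /\ (val w2 \in U2' /\ tq (wkey w2) = elw n).
    rewrite /d2; case: (boolP (x \in xs)) => xx.
      have [w2 [h h']] := vert n nT.
      case: pickP => [w2' /andP[g1 /eqP g2]|/(_ w2)]; last by rewrite h Ed h' eqxx.
      by exists w2'; split=> //; split=> //; rewrite g2 Ed.
    have [v1 [w2 [n' [n2 [G1 G2 _ [G3 G4] G5]]]]] := ret x xL xx.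
    exists w2; split=> //.
    have En' : n' = n by move: Ed; rewrite /d' xL G1 /= G3 => -[].
    have yS : val w2 \in S2 by rewrite inE; apply/hasP; exists x; rewrite // xx G2 /=.
    split; first exact: (subsetP S2U).
    have kJ : wkey w2 \in J by rewrite /J keysE /wkey imset_f.
    by rewrite /tq kJ G4 /= (elwS _ n2) -?En' // En'; apply: SP xx Ed.
  exists w1, w2, n, qq; split=> //; first by split=> //; apply: U1'P E1.
  by rewrite Ew2.
exists d2; split.
- split=> x xx; first by rewrite /d2 (negPf xx).
  have [|w1 [w2 [n [qq [_ E _ _ _]]]]] := main x; first by rewrite mem_cat xx.
  by exists w2.
- apply/conj_holdsP => a aG.
  have xaL x : x \in atom_vars a -> x \in Lv.
    by move=> xa; rewrite /Lv !mem_cat; apply/or3P/Or32; apply/mem_conj_vars; exists a.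
  apply/(atom_holds_local AA_V MM_AA hU2' tU2'); first exact: MM_AA inM aG.
    move=> x w2 /xaL/main[v1 [v2 [n [qq [_ E [_ h] _ _]]]]].
    by rewrite E => -[<-].
  have [aA da] := move_atom MM_AA md' aG.
  apply: (atom_holds_ext (e := pcomp elw d')).
    move=> x /xaL/main[v1 [v2 [n [qq [_ E _ [_ h] [h3 _ h4]]]]]].
    by rewrite /pcomp E h4 /= h h3.
  apply: (sim_sim0 selw) => // x c /xaL/main[v1 [v2 [n [qq [_ _ _ _ [h3 _ h4]]]]]].
  by rewrite h4 => -[<-]; exists qq.
(* The next position compares [N] with [QQ] by the embedding at the node [w] and its inverse. *)
exists U1', U2', N, QQ, t, tq, elw, zw; split=> // x xz.
have [|v1 [v2 [n [qq [E1 E2 h [T1 T2] [h3 h4 _]]]]]] := main x.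
  by rewrite /Lv !mem_cat [x \in zs]xz !orbT.
by exists v1, v2, n, qq; split.
Qed.

End Two.

End Forth.

(** * Passing to an existential positive formula *)

Section Syntax.
Variable sg : vocabulary.

Fixpoint atoms_of (f : formula sg) : seq (atom sg) :=
  match f with
  | FTrue | FFalse => [::]
  | FAtom a => [:: a]
  | FNot f1 => atoms_of f1
  | FAnd f1 f2 | FOr f1 f2 => atoms_of f1 ++ atoms_of f2
  | FEx xs G f1 | FAll xs G f1 => G ++ atoms_of f1
  end.

Fixpoint moves_of (f : formula sg) : seq (seq nat * seq (atom sg)) :=
  match f with
  | FTrue | FFalse | FAtom _ => [::]
  | FNot f1 => moves_of f1
  | FAnd f1 f2 | FOr f1 f2 => moves_of f1 ++ moves_of f2
  | FEx xs G f1 | FAll xs G f1 => (xs, G) :: moves_of f1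
  end.

Lemma atoms_of_vars f a : List.In a (atoms_of f) -> {subset atom_vars a <= all_vars f}.
Proof.
have quant xs (G : seq (atom sg)) f1 :
    (List.In a (atoms_of f1) -> {subset atom_vars a <= all_vars f1}) ->
    List.In a (G ++ atoms_of f1) -> {subset atom_vars a <= xs ++ conj_vars G ++ all_vars f1}.
  move=> IH /(@List.in_app_or _ _ _ _) aG x xa; rewrite !mem_cat; apply/or3P.
  by case: aG => [aG|/IH h]; [apply/Or32/mem_conj_vars; exists a|apply/Or33/h].
elim: f => //=.
- by move=> b [->|].
- move=> f1 IH1 f2 IH2 /(@List.in_app_or _ _ _ _)[/IH1|/IH2] h x /h xf; rewrite mem_cat xf ?orbT //.
- move=> f1 IH1 f2 IH2 /(@List.in_app_or _ _ _ _)[/IH1|/IH2] h x /h xf; rewrite mem_cat xf ?orbT //.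
Qed.

Lemma moves_of_guard g f xs G : guarded g f -> List.In (xs, G) (moves_of f) ->
  is_guard g xs G [::].
Proof.
have sub ys (H : seq (atom sg)) zs : is_guard g ys H zs -> is_guard g ys H [::].
  case: g => /=; first by case: H => [|a []] //; rewrite all_cat cats0 => /andP[].
  move=> /allP h; apply/allP => x /h; rewrite !all_cat => /and3P[-> -> _] //.
elim: f => //=.
- by move=> f1 IH1 f2 IH2 /andP[g1 g2] /(@List.in_app_or _ _ _ _)[/(IH1 g1)|/(IH2 g2)].
- by move=> f1 IH1 f2 IH2 /andP[g1 g2] /(@List.in_app_or _ _ _ _)[/(IH1 g1)|/(IH2 g2)].
- by move=> ys H f1 IH /andP[gH g1] [[<- <-]|/(IH g1)//]; apply: sub gH.
- by move=> ys H f1 IH /andP[gH g1] [[<- <-]|/(IH g1)//]; apply: sub gH.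
Qed.

Lemma moves_of_atoms f xs G a : List.In (xs, G) (moves_of f) -> List.In a G ->
  List.In a (atoms_of f).
Proof.
move=> + aG; elim: f => //=.
- by move=> f1 IH1 f2 IH2 /(@List.in_app_or _ _ _ _)[/IH1|/IH2] h;
    apply: List.in_or_app; [left|right].
- by move=> f1 IH1 f2 IH2 /(@List.in_app_or _ _ _ _)[/IH1|/IH2] h;
    apply: List.in_or_app; [left|right].
- by move=> ys H f1 IH [[_ ->]|/IH h]; apply: List.in_or_app; [left|right].
- by move=> ys H f1 IH [[_ ->]|/IH h]; apply: List.in_or_app; [left|right].
Qed.

Lemma free_all_vars (f : formula sg) : {subset free_vars f <= all_vars f}.
Proof.
elim: f => //=.
- by move=> a x.
- by move=> f1 IH1 f2 IH2 x; rewrite !mem_cat => /orP[/IH1|/IH2] ->; rewrite ?orbT.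
- by move=> f1 IH1 f2 IH2 x; rewrite !mem_cat => /orP[/IH1|/IH2] ->; rewrite ?orbT.
- by move=> xs G f1 IH x; rewrite mem_filter !mem_cat => /andP[_ /orP[|/IH] ->]; rewrite ?orbT.
- by move=> xs G f1 IH x; rewrite mem_filter !mem_cat => /andP[_ /orP[|/IH] ->]; rewrite ?orbT.
Qed.

End Syntax.

(** * Equivalence of two covers for the formula, and the map into the first of them *)

Section Game.
Variables (sg : vocabulary) (g : guarding) (V : seq nat).
Variables (AA : seq (atom sg)) (MM : seq (seq nat * seq (atom sg))).
Hypothesis AA_V : forall a, List.In a AA -> {subset atom_vars a <= V}.
Hypothesis MM_guard : forall xs G, List.In (xs, G) MM -> is_guard g xs G [::].
Hypothesis MM_AA : forall xs G a, List.In (xs, G) MM -> List.In a G -> List.In a AA.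
Variables (k : nat) (A0 : fin_structure sg).
Notation X := (hashed_key g V AA MM k).
Notation Y := (coloured_key g V AA MM k).
Notation typed := (typed A0).
Notation W := (cover g V AA MM k A0).

Lemma position_sym B1 B2 m F (e1 : assignment (W B1)) (e2 : assignment (W B2)) :
  position m F e1 e2 -> position m F e2 e1.
Proof.
move=> [U1 [U2 [N1 [N2 [t1 [t2 [p [pi [[h1 h2] [h3 h4] [h5 h6] h7]]]]]]]]].
exists U2, U1, N2, N1, t2, t1, pi, p; split=> // x.
move=> /h7[w1 [w2 [n1 [n2 [a1 a2 [a3 a4] [a5 a6] [a7 a8]]]]]].
by exists w2, w1, n2, n1.
Qed.

Lemma position_sub B1 B2 m (F F' : pred nat) (e1 : assignment (W B1)) (e2 : assignment (W B2)) :
  subpred F' F -> position m F e1 e2 -> position m F' e1 e2.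
Proof.
move=> sub [U1 [U2 [N1 [N2 [t1 [t2 [p [pi [h1 h3 h5 h7]]]]]]]]].
by exists U1, U2, N1, N2, t1, t2, p, pi; split=> // x /sub/h7.
Qed.

Lemma position_atom B1 B2 m (e1 : assignment (W B1)) (e2 : assignment (W B2)) a :
  List.In a AA -> position m (mem (atom_vars a)) e1 e2 ->
  atom_holds e1 a -> atom_holds e2 a.
Proof.
move=> aA [U1 [U2 [N1 [N2 [t1 [t2 [p [pi [[hU1 hU2] [tU1 tU2] [sp _] PF]]]]]]]]] h.
apply/(atom_holds_local AA_V MM_AA hU2 tU2 aA).
  by move=> x w /PF[w1 [w2 [n1 [n2 [_ -> [_ u] _ _]]]]] [<-].
apply: (atom_holds_ext (e := pcomp p (pcomp (fun w => t1 (wkey w)) e1))).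
  move=> x /PF[w1 [w2 [n1 [n2 [E1 E2 _ [T1 T2] [P1 _]]]]]].
  by rewrite /pcomp E1 E2 /= T1 T2.
apply: (sim_sim0 sp) => //.
  move=> x c /PF[w1 [w2 [n1 [n2 [E1 E2 _ [T1 T2] [P1 _]]]]]].
  by rewrite /pcomp E1 /= T1 => -[<-]; exists n2.
apply/(atom_holds_local AA_V MM_AA hU1 tU1 aA) => //.
by move=> x w /PF[w1 [w2 [n1 [n2 [-> _ [u _] _ _]]]]] [<-].
Qed.

(** Negation exchanges the two covers, and an instance of a universal quantifier is played on the
    second cover and answered on the first. The induction therefore keeps both covers general. *)
Lemma position_holds f : guarded g f -> {subset all_vars f <= V} ->
  (forall a, List.In a (atoms_of f) -> List.In a AA) ->
  (forall mv, List.In mv (moves_of f) -> List.In mv MM) ->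
  forall m B1 B2 (e1 : assignment (W B1)) (e2 : assignment (W B2)),
  typed (set0 : {set X B1}) -> typed (set0 : {set X B2}) ->
  guarded_rank f <= m -> m <= k -> position m (mem (free_vars f)) e1 e2 ->
  holds e1 f -> holds e2 f.
Proof.
elim: f => //=.
- move=> a _ _ aA _ m B1 B2 e1 e2 _ _ _ _; apply: position_atom; apply: aA; by left.
- move=> f IH gf fV fA fM m B1 B2 e1 e2 ty1 ty2 rk mk ps h h'; apply: h.
  exact: IH (position_sym ps) h'.
- move=> f1 IH1 f2 IH2 /andP[g1 g2] fV fA fM m B1 B2 e1 e2 ty1 ty2.
  rewrite geq_max => /andP[r1 r2] mk ps [h1 h2]; split.
    apply: (IH1 _ _ _ _ m B1 B2 e1 e2) => //.
    + by move=> x h; apply: fV; rewrite mem_cat h.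
    + by move=> x h; apply: fA; apply: List.in_or_app; left.
    + by move=> x h; apply: fM; apply: List.in_or_app; left.
    by apply: position_sub ps => x /= h; rewrite mem_cat h.
  apply: (IH2 _ _ _ _ m B1 B2 e1 e2) => //.
  + by move=> x h; apply: fV; rewrite mem_cat h orbT.
  + by move=> x h; apply: fA; apply: List.in_or_app; right.
  + by move=> x h; apply: fM; apply: List.in_or_app; right.
  by apply: position_sub ps => x /= h; rewrite mem_cat h orbT.
- move=> f1 IH1 f2 IH2 /andP[g1 g2] fV fA fM m B1 B2 e1 e2 ty1 ty2.
  rewrite geq_max => /andP[r1 r2] mk ps [h|h]; [left|right].
    apply: (IH1 _ _ _ _ m B1 B2 e1 e2) => //.
    + by move=> x h'; apply: fV; rewrite mem_cat h'.
    + by move=> x h'; apply: fA; apply: List.in_or_app; left.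
    + by move=> x h'; apply: fM; apply: List.in_or_app; left.
    by apply: position_sub ps => x /= h'; rewrite mem_cat h'.
  apply: (IH2 _ _ _ _ m B1 B2 e1 e2) => //.
  + by move=> x h'; apply: fV; rewrite mem_cat h' orbT.
  + by move=> x h'; apply: fA; apply: List.in_or_app; right.
  + by move=> x h'; apply: fM; apply: List.in_or_app; right.
  by apply: position_sub ps => x /= h'; rewrite mem_cat h' orbT.
- move=> xs G f IH /andP[gG gf] fV fA fM [//|m] B1 B2 e1 e2 ty1 ty2 rk mk ps.
  move=> [d1 [re [dG df]]].
  have inM : List.In (xs, G) MM by apply: fM; left.
  rewrite is_guard_live in gG; last exact: MM_guard inM.
  have fV' : {subset all_vars f <= V} by move=> x h; apply: fV; rewrite !mem_cat h !orbT.
  have [d2 [re2 dG2 ps2]] := forth AA_V MM_guard MM_AA ty1 mk ps inM re dG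
    (fun x h => fV' x (free_all_vars h)) gG
    (fun x h xx => etrans (mem_filter _ _ _) (introT andP (conj xx h))).
  exists d2; split=> //; split=> //; apply: (IH _ _ _ _ m B1 B2 d1) => //.
  + by move=> x h; apply: fA; apply: List.in_or_app; right.
  + by move=> x h; apply: fM; right.
  exact: ltnW.
- move=> xs G f IH /andP[gG gf] fV fA fM [//|m] B1 B2 e1 e2 ty1 ty2 rk mk ps hf d2 re dG.
  have inM : List.In (xs, G) MM by apply: fM; left.
  rewrite is_guard_live in gG; last exact: MM_guard inM.
  have fV' : {subset all_vars f <= V} by move=> x h; apply: fV; rewrite !mem_cat h !orbT.
  have [d1 [re1 dG1 ps1]] := forth AA_V MM_guard MM_AA ty2 mk (position_sym ps) inM re dG
    (fun x h => fV' x (free_all_vars h)) gG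
    (fun x h xx => etrans (mem_filter _ _ _) (introT andP (conj xx h))).
  apply: (IH _ _ _ _ m B1 B2 d1) => //; last exact: hf.
  + by move=> x h; apply: fA; apply: List.in_or_app; right.
  + by move=> x h; apply: fM; right.
  + exact: ltnW.
  exact: position_sym.
Qed.

Lemma position_empty B1 B2 (e1 : assignment (W B1)) (e2 : assignment (W B2)) :
  typed (set0 : {set X B1}) -> typed (set0 : {set X B2}) -> position k pred0 e1 e2.
Proof.
have hyp0 B : typed (set0 : {set X B}) -> hyper A0 (set0 : {set Y B}).
  by move=> ty; split; [move=> ? ?; rewrite inE|rewrite /base imset0|move=> c _ y; rewrite inE].
move=> ty1 ty2; have [N1 [t1 h1]] := ty1; have [N2 [t2 h2]] := ty2.
exists set0, set0, N1, N2, t1, t2, (fun=> None), (fun=> None); split=> //.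
- by split; apply: hyp0.
- by rewrite /base !imset0.
have [_ [_ [_ _ _ _ [s1 s1']]] _] := h1; have [_ [_ [_ _ _ _ [s2 s2']]] _] := h2.
by split; [exact (empty_sim_trans MM_AA s1' s2)|exact (empty_sim_trans MM_AA s2' s1)].
Qed.

Lemma typed_set0 (B N : fin_structure sg) (h : N -> B) : is_hom h ->
  empty_sim g V AA MM k A0 N -> empty_sim g V AA MM k N A0 -> typed (set0 : {set X B}).
Proof.
move=> hh s1 s2; exists N, (fun=> None); split.
- by move=> x y; rewrite inE.
- by exists h; split=> // kap; rewrite /keys imset0 inE.
by move=> T'; rewrite subset0 => /eqP->; rewrite eqxx.
Qed.

(* Only tuples matching an atom of the formula are lifted to the cover. *)
Definition matched (A : fin_structure sg) : fin_structure sg :=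
  @FinStructure sg A (fun R t => `[< interp t /\ exists (vs : (arity R).-tuple nat)
    (e : assignment A), List.In (Rel vs) AA /\ map e vs = map Some t >]).

Lemma matched_atom A (e : assignment A) a : List.In a AA ->
  @atom_holds sg (matched A) e a <-> atom_holds e a.
Proof.
case: a => [R vs|x y] //= aA; split=> [[t [E /asboolP[h _]]]|[t [E h]]]; exists t; split=> //.
by apply/asboolP; split=> //; exists vs, e.
Qed.

Lemma matched_holds A f : (forall a, List.In a (atoms_of f) -> List.In a AA) ->
  forall e : assignment A, @holds sg (matched A) e f <-> holds e f.
Proof.
have cj (e : assignment A) G : (forall a, List.In a G -> List.In a AA) ->
    @conj_holds sg (matched A) e G <-> conj_holds e G.
  by move=> GA; split=> /conj_holdsP h; apply/conj_holdsP => a aG; apply/matched_atom; auto.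
elim: f => //=.
- by move=> a aA e; apply: matched_atom; apply: aA; left.
- by move=> f IH fA e; split=> h h'; apply: h; apply/IH.
- move=> f1 IH1 f2 IH2 fA e.
  rewrite IH1 ?IH2 //; by move=> a h; apply: fA; apply: List.in_or_app; auto.
- move=> f1 IH1 f2 IH2 fA e.
  rewrite IH1 ?IH2 //; by move=> a h; apply: fA; apply: List.in_or_app; auto.
- move=> xs G f IH fA e.
  have fA1 a : List.In a G -> List.In a AA by move=> h; apply: fA; apply: List.in_or_app; auto.
  have fA2 a : List.In a (atoms_of f) -> List.In a AA.
    by move=> h; apply: fA; apply: List.in_or_app; auto.
  by split=> -[d [re [dG df]]]; exists d; split=> //; split; (exact/cj || exact/IH).
move=> xs G f IH fA e.
have fA1 a : List.In a G -> List.In a AA by move=> h; apply: fA; apply: List.in_or_app; auto.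
have fA2 a : List.In a (atoms_of f) -> List.In a AA.
  by move=> h; apply: fA; apply: List.in_or_app; auto.
by split=> h d re dG; (apply/IH => //; apply: h => //; apply/cj).
Qed.

(** [A0] realises the set of all keys with index 0 over itself, so extending the empty hyperedge
    gives one hyperedge containing a vertex for each element of [A0]. *)
Lemma matched_to_cover : typed (set0 : {set X A0}) -> exists u : matched A0 -> W A0, is_hom u.
Proof.
move=> ty0.
pose I2 : {set cover_key V A0} := [set kap | kap.2 == ord0].
pose t2 (kap : cover_key V A0) : option A0 := if kap.2 == ord0 then Some kap.1 else None.
have id_hom : is_hom (id : A0 -> A0).
  by move=> R t; congr (is_true (interp _)); apply: val_inj; rewrite /= map_id.
have es : empty_sim g V AA MM k A0 A0 by apply: sim_sub (sim_id g V AA MM k A0).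
have rz : realises g AA MM k A0 I2 t2.
  exists id; split=> //.
  - by move=> kap; rewrite inE /t2; case: ifP.
  - by move=> kap x; rewrite /t2; case: ifP => // _ [].
  move=> [a i] [b j] x; rewrite /t2 /=.
  by case: ifP => // /eqP-> [<-]; case: ifP => // /eqP-> [<-].
have hyp0 : hyper A0 (set0 : {set Y A0}).
  by split; [move=> ? ?; rewrite inE|rewrite /base imset0|move=> c _ y; rewrite inE].
have b0 : base (set0 : {set Y A0}) = set0 by rewrite /base imset0.
have [||U2 [_ hU2 tU2 kU2]] := hyper_extend hyp0 rz.
- by rewrite b0 /keys imset0 sub0set.
- by move=> T'; rewrite b0 subset0 => ->.
have [a|u uP] := @choice A0 (W A0) (fun a w => val w \in U2 /\ wkey w = (a, ord0)).
  have : (a, ord0) \in keys (base U2) by rewrite kU2 inE.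
  rewrite keysE => /imsetP[y yU E].
  have hy : `[< hyper A0 [set y] >] by apply/asboolP; apply: hyper_sub hU2; rewrite sub1set.
  by exists (Sub y hy).
exists u => R t /asboolP[It [vs [e [aA Et]]]].
suff [s [Es Is]] : atom_holds (pcomp (fun a => Some (u a)) e : assignment (W A0)) (Rel vs).
  rewrite (_ : map_tuple u t = s) //; apply: val_inj; apply: (inj_map (@Some_inj _)).
  rewrite -Es (eq_map (g := omap u \o e)); last by move=> x; rewrite /pcomp /=; case: (e x).
  by rewrite map_comp Et /= -!map_comp.
apply/(atom_holds_local AA_V MM_AA hU2 tU2 aA).
  by move=> x w _; rewrite /pcomp; case: (e x) => //= a [<-]; have [] := uP a.
exists t; split=> //; rewrite -Et; apply: eq_map => x; rewrite /pcomp.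
by case: (e x) => //= a; rewrite /t2; have [_ ->] := uP a; rewrite /=.
Qed.

End Game.

(** * Preservation under simulations and the characteristic formula *)

Section Main.
Variables (sg : vocabulary) (g : guarding) (k : nat) (phi : formula sg).
Hypotheses (phi_guarded : guarded g phi) (phi_sentence : is_sentence phi).
Hypotheses (phi_rank : guarded_rank phi <= k).
Hypothesis phi_homs : preserved_under_fin_homs phi.
Let V := all_vars phi.
Let AA := atoms_of phi.
Let MM := moves_of phi.

Lemma sim_preserved (A B : fin_structure sg) :
  empty_sim g V AA MM k A B -> models A phi -> models B phi.
Proof.
move=> sAB hA.
have AA_V a : List.In a AA -> {subset atom_vars a <= V} by apply: atoms_of_vars.
have MM_guard xs G : List.In (xs, G) MM -> is_guard g xs G [::].
  exact: moves_of_guard phi_guarded.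
have MM_AA xs G a : List.In (xs, G) MM -> List.In a G -> List.In a AA.
  exact: moves_of_atoms.
have tyA : typed A (set0 : {set hashed_key g V AA MM k A}).
  have es : empty_sim g V AA MM k A A by apply: sim_sub (sim_id g V AA MM k A).
  apply: (typed_set0 (h := id) _ es es) => R t.
  by congr (is_true (interp _)); apply: val_inj; rewrite /= map_id.
(* The empty set is realised over [B] by the unravelling of [A] along the simulation with empty
   domain: it maps to [B], and it is equivalent to [A] from the empty position. *)
have tyB : typed A (set0 : {set hashed_key g V AA MM k B}).
  have rK (a : A) (y : B) : None = Some y -> None = Some a by [].
  have kF : ~~ false -> forall a : A, None = None :> option B by [].
  pose Q := unravelling g V AA MM (fun _ : A => None : option B) k false.
  apply: (typed_set0 (h := fun z : Q => proj z)).
  - exact: hom_proj sAB rK kF.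
  - by apply: sim_sub (sim_node_elt sAB rK kF (w := [::]) _ _); rewrite //= addn0.
  by apply: sim_sub (sim_node_inv MM_guard MM_AA sAB rK _ kF (w := [::]) _ _).
have [u hu] := matched_to_cover AA_V MM_AA tyA.
apply: (phi_homs (cover_hom (A0 := A) (B := B) (g := g) (V := V) (AA := AA) (MM := MM) (k := k))).
apply: (@position_holds _ g V AA MM AA_V MM_guard MM_AA k A phi _ _ _ _ k A B (fun=> None)) => //.
  apply: position_sub (position_empty MM_AA _ _ tyA tyB) => x /=.
  by move/nilP: phi_sentence => ->.
apply: (phi_homs hu); exact/matched_holds.
Qed.

Let Cs := [seq f <- cand g V AA MM k | is_sentence f].
Definition theory (A : fin_structure sg) := [seq f <- Cs | `[< models A f >]].
Definition realised S := `[< exists2 A, models A phi & S = theory A >].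
(** The models of [phi] may be infinitely many, but their theories are sublists of [Cs], so the
    disjunction is finite. *)
Definition char_formula : formula sg :=
  bigor (map (@bigand sg) [seq S <- subs Cs | realised S]).

Lemma char_In f : List.In f (map (@bigand sg) [seq S <- subs Cs | realised S]) <->
  exists2 A, models A phi & f = bigand (theory A).
Proof.
split=> [/List.in_map_iff[S [<- /In_filter[_ /asboolP[A hA ->]]]]|[A hA ->]]; first by exists A.
apply: List.in_map; apply/In_filter; split; first exact: In_subs.
by apply/asboolP; exists A.
Qed.

Lemma theory_In A f : List.In f (theory A) <->
  [/\ List.In f (cand g V AA MM k), is_sentence f & models A f].
Proof.
split=> [/In_filter[/In_filter[h1 h2] /asboolP h3]|[h1 h2 h3]] //.
by apply/In_filter; split; [apply/In_filter|apply/asboolP].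
Qed.

Lemma char_good : good g V k char_formula.
Proof.
apply: good_bigor => f /char_In[A _ ->]; apply: good_bigand => f' /theory_In[h _ _].
exact: cand_good h.
Qed.

Lemma char_sentence : is_sentence char_formula.
Proof.
apply/nilP; case E: (free_vars char_formula) => [|x s] //.
have /free_bigor[f /char_In[A _ ->]] : x \in free_vars char_formula by rewrite E mem_head.
by move=> /free_bigand[f' /theory_In[_ /nilP-> _]].
Qed.

(** A structure satisfying the theory of a model [A] of [phi] is simulated by [A] from the empty
    position, by [th_sim] with no named elements, and [phi] passes along such simulations. *)
Lemma char_equivalent : fin_equivalent phi char_formula.
Proof.
move=> B; split=> [hB|/holds_bigor[f /char_In[A hA ->] /holds_bigand hB]].
  apply/holds_bigor; exists (bigand (theory B)); first by apply/char_In; exists B.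
  by apply/holds_bigand => f /theory_In[].
apply: sim_preserved hA.
apply: (th_sim _ _ _ (e := fun=> None) (e' := fun=> None) (D := [::])) => //.
- by move=> a; apply: atoms_of_vars.
- by move=> xs G; apply: moves_of_guard phi_guarded.
- by move=> xs G a; apply: moves_of_atoms.
move=> f1 fC fv hf; apply: hB; apply/theory_In; split=> //.
by apply/nilP; case: (free_vars f1) fv => // x s /(_ x (mem_head _ _)).
Qed.

End Main.

Lemma ep_preserved sg (psi : formula sg) : existential_positive psi -> preserved_under_fin_homs psi.
Proof.
by move=> ep A B h hh hA; have := ep_hom hh ep hA; rewrite /models; congr holds.
Qed.

Theorem theorem4p24 (g : guarding) (sg : vocabulary) (n k : nat)
    (n_gt0 : 0 < n) (k_gt0 : 0 < k)
    (phi : formula sg) (phi_guarded : guarded_sentence g n k phi) :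
  preserved_under_fin_homs phi <->
  exists psi : formula sg,
    [/\ existential_positive psi, guarded_sentence g n k psi
      & fin_equivalent phi psi].
Proof.
split=> [homs|[psi [ep _ eqv]] A B h hh /eqv hA]; last exact/eqv/(ep_preserved ep hh).
have [gphi sphi nphi rphi] := phi_guarded.
have /and4P[h1 h2 /allP h3 h4] := char_good g k phi.
exists (char_formula g k phi); split=> //; last exact: char_equivalent.
split=> //; first exact: char_sentence.
(* The variables of the new formula are among those of [phi]. *)
apply: leq_trans nphi; apply: uniq_leq_size; first exact: undup_uniq.
by move=> x; rewrite !mem_undup; apply: h3.
Qed.
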